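(* Suppose that the Littlewood conjecture is true, i.e. that for every pair of real numbers $\alpha,\beta$, $$\liminf_{n\to\infty} n\|n\alpha\|\|n\beta\|=0,$$ where $n$ runs over positive integers and $\|x\|$ denotes the distance from $x\in\mathbb{R}$ to the nearest integer. Then, for all integers $k>d\ge1$ with $(k,d)\neq(2,1)$, there are no $k$ to $d$ cubical cut and project sets which are $\mathrm{LR}$ with respect to $\mathcal{R}_d$, where $\mathcal{R}_d$ is the collection of aligned rectangles in $\mathbb{R}^d$ with non-empty interior and all vertices in $\mathbb{Z}^d$ (aligned means all faces are parallel to coordinate hyperplanes).
   Context: **Cut and project sets.** Let $k>d\ge1$ be integers and $e_1,\dots,e_k$ the standard basis of $\mathbb{R}^k$. Let $E\subseteq\mathbb{R}^k$ be a $d$-dimensional subspace, $F_\pi\subseteq\mathbb{R}^k$ a subspace complementary to $E$, and $\pi:\mathbb{R}^k\to E$ the projection with respect to $\mathbb{R}^k=E+F_\pi$; it is assumed that $\pi|_{\mathbb{Z}^k}$ is injective. For a set (window) $\mathcal{W}_\pi\subseteq F_\pi$ put $\mathcal{S}=\mathcal{W}_\pi+E$ (the strip). For $s\in\mathbb{R}^k/\mathbb{Z}^k$, the set $Y=Y_s=\pi(\mathcal{S}\cap(\mathbb{Z}^k+s))\subseteq E$ is called a $k$ to $d$ cut and project set. It is regular if $(\mathbb{Z}^k+s)\cap\partial\mathcal{S}=\emptyset$. $E$ is totally irrational if its canonical projection to $\mathbb{R}^k/\mathbb{Z}^k$ is dense. $Y$ is aperiodic if the only $x\in E$ with $Y+x=Y$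 is $x=0$. Let $F_\rho=\{0\}\times\mathbb{R}^{k-d}$; it is assumed that $E$ is complementary to $F_\rho$ (so $E$ is the graph of a linear map $\mathbb{R}^d\to\mathbb{R}^{k-d}$). Let $\rho:\mathbb{R}^k\to E$ be the projection with respect to $\mathbb{R}^k=E+F_\rho$. Put $\mathcal{W}=\mathcal{S}\cap F_\rho$ (also called the window; $\mathcal{S}=\mathcal{W}+E$). The window is cubical if $\mathcal{W}=\{\sum_{i=d+1}^k t_ie_i:0\le t_i<1\}$. A cubical cut and project set is a regular, totally irrational (meaning $E$ is totally irrational), aperiodic cut and project set with cubical window. **Patterns.** Subsets of $\mathbb{R}^d$ are regarded as subsets of $\langle e_1,\dots,e_d\rangle_{\mathbb{R}}\subseteq\mathbb{R}^k$, and as subsets of $E$ via $\rho$. For $y\in Y$, $\tilde y\in\mathbb{Z}^k$ is the unique point with $\pi(\tilde y+s)=y$. For bounded $\Omega\subseteq\mathbb{R}^d$ and $y\in Y$, the patch of shape $\Omega$ at $y$ is $P(y,\Omega)=\{y'\in Y:\rho(\tilde y'-\tilde y)\in\rho(\Omega)\}$. Patches $P(y_1,\Omega)$ and $P(y_2,\Omega)$ are equivalent if $P(y_1,\Omega)=P(y_2,\Omega)+y_1-y_2$; a pattern of shape $\Omega$ is an equivalence class of patches. A pattern of shape $\Omega$ occurs in a region $R\subseteq\mathbb{R}^d$ if there is $y\in Y\cap\rho(R)$ such that $P(y,\Omega)$ belongs to that class. **LR.** For a collection $\mathcal{A}$ of bounded measurable subsets of $\mathbb{R}^d$, $Y$ is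 LR with respect to $\mathcal{A}$ if there is a constant $C>0$ such that for every $\Omega\in\mathcal{A}$, every pattern of shape $\Omega$ in $Y$ occurs in every ball of volume $C|\Omega|$ in $\mathbb{R}^d$, where $|\Omega|$ is the $d$-dimensional Lebesgue measure of $\Omega$. *)

(* Defs.v *)
From HB Require Import structures.
From mathcomp Require Import all_boot all_order all_algebra.
From mathcomp Require Import generic_quotient.
From mathcomp Require Import all_classical all_reals all_analysis.

Set Implicit Arguments.
Unset Strict Implicit.
Unset Printing Implicit Defensive.

Import Order.TTheory GRing.Theory Num.Theory.
Import numFieldNormedType.Exports.

Local Open Scope quotient_scope.
Local Open Scope classical_set_scope.
Local Open Scope ring_scope.

Section Littlewood.
Variable R : realType.

Definition dist_int (x : R) : R := inf [set `|x - m%:~R| | m in [set: int]].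

(* The liminf is taken in the extended reals, where it always exists; the
   sequence is indexed from n = 1. *)
Definition littlewood : Prop := forall a b : R,
  limn_einf (fun n : nat =>
    (n.+1%:R * dist_int (n.+1%:R * a) * dist_int (n.+1%:R * b))%:E) = 0%E.

End Littlewood.

Section Torus.
Variables (R : realType) (k : nat).

Definition Zpoint : {pred 'rV[R]_k} :=
  [pred x : 'rV[R]_k | [forall i, x 0 i \is a Num.int]].

Definition Zcongr : rel 'rV[R]_k := fun x y => x - y \in Zpoint.

Lemma Zcongr_equiv : equiv_class_of Zcongr.
Proof.
split=> [x|x y|y x z]; rewrite /Zcongr.
- by rewrite subrr inE; apply/forallP => i; rewrite mxE rpred0.
- rewrite -opprB !inE; apply/forallP/forallP => h i.
  + by have := h i; rewrite mxE rpredN.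
  + by rewrite mxE rpredN.
- rewrite !inE => /forallP h1 /forallP h2; apply/forallP => i.
  have := h1 i; have := h2 i; rewrite !mxE => h3 h4.
  by rewrite -(subrKA (y 0 i)) rpredD.
Qed.

Canonical Zcongr_equiv_rel := EquivRelPack Zcongr_equiv.

Definition torus : Type := quotient_topology {eq_quot Zcongr}.
HB.instance Definition _ := Topological.on torus.
HB.instance Definition _ := Quotient.on torus.

Definition to_torus (x : 'rV[R]_k) : torus := \pi_torus x.

End Torus.

Section Volume.
Variables (R : realType) (d : nat).

Definition rectangle (a b : 'rV[R]_d) : set 'rV[R]_d :=
  [set x | forall i, a 0 i <= x 0 i <= b 0 i].

(* Lebesgue (outer) measure on R^d, by countable covers by boxes. *)
Definition volume (A : set 'rV[R]_d) : \bar R :=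
  ereal_inf [set v | exists a b : nat -> 'rV[R]_d,
    [/\ forall n i, a n 0 i <= b n 0 i,
        A `<=` \bigcup_n rectangle (a n) (b n) &
        v = (\sum_(0 <= n <oo) (\prod_(i < d) (b n 0 i - a n 0 i))%:E)%E]].

(* Euclidean balls: the library norm on row vectors is the sup norm. *)
Definition euclidean_ball (c : 'rV[R]_d) (r : R) : set 'rV[R]_d :=
  [set x | Num.sqrt (\sum_(i < d) (x 0 i - c 0 i) ^+ 2) <= r].

Definition rectangle_vertex (a b v : 'rV[R]_d) : Prop :=
  forall i, v 0 i = a 0 i \/ v 0 i = b 0 i.

Definition integer_rectangles : set (set 'rV[R]_d) :=
  [set Omega | exists a b : 'rV[R]_d,
    [/\ Omega = rectangle a b, Omega° !=set0 &
        forall v, rectangle_vertex a b v -> v \in @Zpoint R d]].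

End Volume.

Section CutAndProject.
Variables (R : realType) (k d : nat).

Definition F_rho : {vspace 'rV[R]_k} :=
  (\sum_(i < k | (d <= i)%N) <[(delta_mx 0 i : 'rV[R]_k)%R]>)%VS.

Definition complementary (U V : {vspace 'rV[R]_k}) : Prop :=
  (U + V = fullv)%VS /\ (U :&: V = 0)%VS.

(* [cp_shift] is a representative s in R^k of a class in R^k / Z^k. *)
Record cut_and_project := CutAndProject {
  cp_E : {vspace 'rV[R]_k};
  cp_Fpi : {vspace 'rV[R]_k};
  cp_Wpi : set 'rV[R]_k;
  cp_shift : 'rV[R]_k;
  cp_dimE : \dim cp_E = d;
  cp_Fpi_compl : complementary cp_E cp_Fpi;
  cp_Frho_compl : complementary cp_E F_rho;
  cp_pi_inj : {in @Zpoint R k &, injective (daddv_pi cp_E cp_Fpi)};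
  cp_Wpi_sub : cp_Wpi `<=` [set x | x \in cp_Fpi]
}.

Variable P : cut_and_project.

Definition cp_pi : 'End('rV[R]_k) := daddv_pi (cp_E P) (cp_Fpi P).
Definition cp_rho : 'End('rV[R]_k) := daddv_pi (cp_E P) F_rho.

Definition cp_strip : set 'rV[R]_k :=
  [set w + x | w in cp_Wpi P & x in [set x | x \in cp_E P]].

Definition cp_lattice : set 'rV[R]_k :=
  [set n + cp_shift P | n in [set n | n \in @Zpoint R k]].

Definition cp_set : set 'rV[R]_k := cp_pi @` (cp_strip `&` cp_lattice).

Definition cp_window : set 'rV[R]_k := cp_strip `&` [set x | x \in F_rho].

Definition regular : Prop :=
  cp_lattice `&` (closure cp_strip `\` cp_strip°) = set0.

Definition totally_irrational : Prop :=
  dense (@to_torus R k @` [set x | x \in cp_E P]).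

Definition aperiodic : Prop :=
  forall x, x \in cp_E P -> [set y + x | y in cp_set] = cp_set -> x = 0.

Definition cubical_window : Prop :=
  cp_window = [set \sum_(i < k | (d <= i)%N) t i *: (delta_mx 0 i : 'rV[R]_k)
              | t in [set t : 'I_k -> R |
                     forall i : 'I_k, (d <= i)%N -> 0 <= t i < 1]].

Definition cubical : Prop :=
  [/\ regular, totally_irrational, aperiodic & cubical_window].

(* [x *m pid_mx d] is (x, 0), the point x of R^d seen in <e_1, ..., e_d>. *)
Definition rho_set (A : set 'rV[R]_d) : set 'rV[R]_k :=
  [set cp_rho (x *m pid_mx d) | x in A].

(* For y in the cut and project set, the integer point over y; it exists by
   definition of [cp_set] and is unique by [cp_pi_inj]. *)
Definition tilde (y : 'rV[R]_k) : 'rV[R]_k :=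
  xget 0 [set n | n \in @Zpoint R k /\ cp_pi (n + cp_shift P) = y].

Definition patch (y : 'rV[R]_k) (Omega : set 'rV[R]_d) : set 'rV[R]_k :=
  [set y' | cp_set y' /\ rho_set Omega (cp_rho (tilde y' - tilde y))].

Definition patch_equiv (Omega : set 'rV[R]_d) (y1 y2 : 'rV[R]_k) : Prop :=
  patch y1 Omega = [set z + y1 - y2 | z in patch y2 Omega].

(* A pattern, i.e. an equivalence class of patches of shape [Omega], is given
   as the set of the points at which these patches are based. *)
Definition is_pattern (Omega : set 'rV[R]_d) (C : set 'rV[R]_k) : Prop :=
  exists2 y, cp_set y & C = [set y' | cp_set y' /\ patch_equiv Omega y' y].

Definition occurs_in (C : set 'rV[R]_k) (A : set 'rV[R]_d) : Prop :=
  exists2 y, (cp_set `&` rho_set A) y & C y.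

(* [coll] is meant to consist of bounded measurable sets. *)
Definition LR (coll : set (set 'rV[R]_d)) : Prop :=
  exists2 c : R, 0 < c & forall Omega, coll Omega ->
    forall C, is_pattern Omega C ->
    forall (x : 'rV[R]_d) (r : R), 0 < r ->
      volume (euclidean_ball x r) = (c%:E * volume Omega)%E ->
      occurs_in C (euclidean_ball x r).

End CutAndProject.

(* Main.v *)
Require Import Defs.
From mathcomp Require Import all_boot all_order all_algebra.
From mathcomp Require Import generic_quotient.
From mathcomp Require Import all_classical all_reals all_analysis.
From mathcomp Require Import zify ring lra.

Set Implicit Arguments.
Unset Strict Implicit.
Unset Printing Implicit Defensive.

Import Order.TTheory GRing.Theory Num.Theory.
Import numFieldNormedType.Exports.

Local Open Scope classical_set_scope.
Local Open Scope ring_scope.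

(** Write [k = d + c]. The space [E] is the graph of [x |-> x A], and with a
    cubical window the cut and project set has exactly one point over each
    [n] in Z^d. The patch of shape [Omega] at this point is governed by the
    phases [w_i(n) = {sigma_i - L_i(n)}], where [L_1, ..., L_c] are the columns
    of [A]: it records in which cell of the partition of [0, 1) by the points
    [{L_i(m)}], [m] in [Omega], each [w_i(n)] lies.

    Suppose LR holds with constant [C]. If [f = {L_i(v)} > 0] then the event
    [w_i(n) < f] is visible in the box spanned by [0] and [v], so it occurs in
    every ball of volume [O(prod_j max(1, |v_j|))]; but it has frequency at most
    about [f], because the translates of [[0, f)] by multiples of [f] are
    disjoint. Hence [{L_i(v)} prod_j max(1, |v_j|)] is bounded below.

    Counting cells against points of a ball for the boxes [N x 1 x ... x 1]
    shows that at most one form has an irrational [j]-th coefficient, and that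
    a form with an irrational coefficient has a second one if [d >= 2].
    Aperiodicity gives each [j] some irrational coefficient, and density of [E]
    gives each form one. So, unless [(k, d) = (2, 1)], some form has two
    irrational coefficients [alpha], [beta], and
    [max(1, |m|) max(1, |n|) ||m alpha + n beta||] is bounded below. By
    transference this contradicts the Littlewood conjecture for
    [(alpha, beta)]. *)

(** * Fractional parts and the Littlewood conjecture *)

Section FractionalPart.
Variable R : realType.
Implicit Types (x y w l : R) (z : int).

Definition fpart x : R := x - (Num.floor x)%:~R.

Lemma fpart_itv x : 0 <= fpart x < 1.
Proof.
rewrite /fpart; have := floor_itv x; rewrite intrD => /andP[h1 h2].
by apply/andP; split; lra.
Qed.

Lemma fpart_uniq x w z : x = w + z%:~R -> 0 <= w < 1 -> fpart x = w.
Proof.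
move=> -> /andP[w0 w1]; rewrite /fpart (@floor_def _ _ z) ?addrK//.
by rewrite intrD; apply/andP; split; lra.
Qed.

Lemma fpart_small x : 0 <= x < 1 -> fpart x = x.
Proof. by move=> hx; apply: (@fpart_uniq _ _ 0); rewrite ?addr0. Qed.

Lemma fpartD_int x z : fpart (x + z%:~R) = fpart x.
Proof.
apply: (@fpart_uniq _ _ (Num.floor x + z)); last exact: fpart_itv.
by rewrite /fpart intrD; ring.
Qed.

Lemma fpart_eq0 x : (fpart x == 0) = (x \is a Num.int).
Proof. by rewrite /fpart subr_eq0 eq_sym -intrEfloor. Qed.

Lemma fpartE x : x = fpart x + (Num.floor x)%:~R.
Proof. by rewrite /fpart subrK. Qed.

Lemma fpart_eqP x y : reflect (exists z, x = y + z%:~R) (fpart x == fpart y).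
Proof.
apply: (iffP eqP) => [h|[z ->]]; last exact: fpartD_int.
exists (Num.floor x - Num.floor y).
by rewrite intrB [LHS]fpartE h [in X in _ = X + _](fpartE y); ring.
Qed.

(** The integer bringing [w - l] back into [0, 1) is the floor of [l], or one more when
    [w < fpart l]. This turns differences of levels, hence patches, into comparisons of phases with
    thresholds. *)
Lemma fpart_leE w l z : 0 <= w < 1 -> 0 <= w + z%:~R - l < 1 ->
  (fpart l <= w) = (z == Num.floor l).
Proof.
move=> /andP[w0 w1] /andP[h0 h1]; have /andP[f0 f1] := fpart_itv l.
have hl := fpartE l; set g := Num.floor l in hl *.
apply/idP/eqP => [hw|hz]; last by rewrite hz in h0; lra.
apply/eqP; rewrite eq_le.
have : (z%:~R - g%:~R : R) < 1 by lra.
have : (-1 : R) < z%:~R - g%:~R by lra.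
rewrite -intrB -[1%R]/(1%:~R) -[X in X < _]/((-1)%:~R) !ltr_int => u1 u2.
by apply/andP; split; lia.
Qed.

(** Rounding attains the infimum: integers up to [x] are no closer than the floor, larger ones no
    closer than the floor plus one. *)
Lemma dist_int_ex x : exists z, `|x - z%:~R| <= dist_int x.
Proof.
have /andP[f0 f1] := fpart_itv x; have hx := fpartE x.
set f := Num.floor x in hx.
pose z := if fpart x <= 1 / 2 then f else f + 1.
exists z; apply: lb_le_inf; first by exists `|x - 0%:~R|; exists 0.
move=> _ [m _ <-].
have zz : `|x - z%:~R| <= 1 / 2 /\ `|x - z%:~R| <= fpart x /\
          (m%:~R <= f%:~R :> R \/ f%:~R + 1 <= m%:~R :> R).
  split; [|split].
  - by rewrite /z; case: ifPn => [h|]; rewrite -?ltNge ?intrD => *;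
      rewrite ler_norml; apply/andP; split; lra.
  - rewrite /z; case: ifPn => [h|]; rewrite -?ltNge ?intrD => *;
      by rewrite ler_norml; apply/andP; split; lra.
  - case: (lerP m f) => h; first by left; rewrite ler_int.
    by right; rewrite -[1]/(1%:~R) -intrD ler_int; lia.
have zz' : `|x - z%:~R| <= 1 - fpart x \/ fpart x <= 1/2.
  rewrite /z; case: ifPn => [h|]; rewrite -?ltNge ?intrD => *; first by right.
  by left; rewrite ler_norml; apply/andP; split; lra.
case: zz => z1 [z2 [hm|hm]].
  by apply: le_trans (ler_norm _); lra.
rewrite [leRHS]distrC; apply: le_trans (ler_norm _).
by case: zz' => ?; lra.
Qed.

End FractionalPart.

Section LittlewoodDual.
Variable R : realType.
Implicit Types (a b eta : R) (m n z : int).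

(** If every term were at least [eta], so would be the liminf. *)
Lemma littlewood_small a b eta : littlewood R -> 0 < eta ->
  exists2 q : nat, (0 < q)%N &
    q%:R * dist_int (q%:R * a) * dist_int (q%:R * b) < eta.
Proof.
move=> /(_ a b) hL eta0; apply: contrapT => hno.
have : (eta%:E <= 0%E :> \bar R)%E.
  rewrite -hL limn_einf_lim.
  apply: lime_ge; first exact: is_cvg_einfs.
  apply: nearW => n; apply: le_ereal_inf_tmp => _ [p _ <-].
  rewrite lee_fin leNgt; apply/negP => h; apply: hno.
  by exists p.+1.
by rewrite lee_fin leNgt eta0.
Qed.

Lemma truncn_div_le (x y : R) : 0 <= x -> 0 < y ->
  (Num.trunc (x / y))%:R * y <= x.
Proof.
by move=> x0 y0; rewrite -ler_pdivlMr// truncn_le divr_ge0 // ltW.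
Qed.

(** The shrunken box still has more than [q] points, as the pigeonhole needs, but the product of its
    sides is now at most [q], which a later division by [q] absorbs. *)
Lemma trim_box (q M N : nat) : (0 < q)%N -> (q < M.+1 * N.+1)%N ->
  exists M0 N0, [/\ (M0 <= M)%N, (N0 <= N)%N, (q < M0.+1 * N0.+1)%N &
    (maxn 1 M0 * maxn 1 N0 <= q)%N].
Proof.
move=> q0 hq; exists (minn M q), (minn N (q %/ (minn M q).+1)).
set M0 := minn M q; split; rewrite ?geq_minl//.
  rewrite /minn; case: ifPn => h; last by rewrite mulnC ltn_ceil.
  rewrite /M0 /minn; case: ifPn => // _.
  by rewrite (leq_trans (ltnSn q))// leq_pmulr.
set N0 := minn _ _.
have h1 : (M0 <= q)%N by exact: geq_minr.
have h2 : (N0 * M0.+1 <= q)%N.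
  by apply: leq_trans (leq_trunc_div q M0.+1); rewrite leq_mul2r geq_minr orbT.
case: (posnP M0) h1 h2 => [->|m0] h1 h2; case: (posnP N0) h2 => [->|n0] h2.
- by [].
- by rewrite (maxn_idPl _)// (maxn_idPr _)// mul1n -(muln1 N0).
- by rewrite (maxn_idPr _)// (maxn_idPl _)// muln1.
- by rewrite !(maxn_idPr _)// mulnC (leq_trans _ h2)// leq_mul2l leqnSn orbT.
Qed.

(* Pigeonhole on the residues of [m a + n b] modulo [q], in a box of more than
   [q] points whose sides are both short enough for the approximation. *)
Lemma small_relation (q M N : nat) (a b : int) : (0 < q)%N ->
  (q < M.+1 * N.+1)%N ->
  exists m n z, [/\ (m != 0) || (n != 0), (`|m| <= M)%N, (`|n| <= N)%N &
    m * a + n * b = z * q%:Z].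
Proof.
move=> q0 hq.
have hr (x : 'I_M.+1 * 'I_N.+1) :
    (`|((x.1 : nat)%:Z * a + (x.2 : nat)%:Z * b) %% q%:Z|%Z < q)%N.
  by rewrite -ltz_nat gez0_abs ?modz_ge0 ?ltz_pmod//; lia.
pose f x := Ordinal (hr x).
have : ~~ injectiveb f.
  apply/negP => /injectiveP /leq_card.
  by rewrite card_prod !card_ord leqNgt hq.
case/injectivePn => x [y xy fxy].
exists ((x.1 : nat)%:Z - (y.1 : nat)%:Z), ((x.2 : nat)%:Z - (y.2 : nat)%:Z).
have : ((x.1 : nat)%:Z * a + (x.2 : nat)%:Z * b ==
        (y.1 : nat)%:Z * a + (y.2 : nat)%:Z * b %[mod q%:Z])%Z.
  move/(congr1 val): fxy => /= h.
  by rewrite -[X in X == _]gez0_abs ?modz_ge0 ?h ?gez0_abs ?modz_ge0//; lia.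
rewrite eqz_mod_dvd => /dvdzP[z hz]; exists z; split.
- rewrite -negb_and; apply: contra xy => /andP[/eqP h1 /eqP h2].
  by apply/eqP; case: x y h1 h2 {fxy hz} => [x1 x2] [y1 y2] /= h1 h2;
     congr pair; apply: val_inj => /=; lia.
- have := ltn_ord x.1; have := ltn_ord y.1; lia.
- have := ltn_ord x.2; have := ltn_ord y.2; lia.
- by rewrite -hz; ring.
Qed.

(* The easy half of the Cassels--Swinnerton-Dyer transference. *)
Lemma littlewood_dual a b eta : littlewood R -> 0 < eta -> eta < 1 ->
  exists m n z, [/\ (m != 0) || (n != 0) &
    (maxn 1 `|m|)%:R * (maxn 1 `|n|)%:R * `|m%:~R * a + n%:~R * b - z%:~R|
      <= eta].
Proof.
(* Half of [eta] goes to each of [m s] and [n t]; the bound [e * e] makes a box with sides [e / |s|]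
   and [e / |t|] hold more than [q] points. *)
move=> hL eta0 eta1; pose e := eta / 2.
have e0 : 0 < e by rewrite /e; lra.
have [q q0 hq] := littlewood_small a b hL (mulr_gt0 e0 e0).
have [x hx] := dist_int_ex (q%:R * a); have [y hy] := dist_int_ex (q%:R * b).
set s := q%:R * a - x%:~R in hx; set t := q%:R * b - y%:~R in hy.
have qR0 : (0 : R) < q%:R by rewrite ltr0n.
(* If [q a] or [q b] is an integer, then (q, 0) or (0, q) gives an exact relation. *)
have [s0|s0] := eqVneq s 0.
  exists q%:Z, 0, x; split; first by apply/orP; left; lia.
  rewrite -pmulrn mul0r addr0 -/s s0 normr0 mulr0; lra.
have [t0|t0] := eqVneq t 0.
  exists 0, q%:Z, y; split; first by apply/orP; right; lia.
  rewrite -pmulrn mul0r add0r -/t t0 normr0 mulr0; lra.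
have {}s0 : 0 < `|s| by rewrite normr_gt0.
have {}t0 : 0 < `|t| by rewrite normr_gt0.
have qst : q%:R * (`|s| * `|t|) < e * e.
  rewrite mulrA; apply: le_lt_trans hq.
  by rewrite ler_pM// ?mulr_ge0 ?ler_wpM2l// ltW.
pose M := Num.trunc (e / `|s|); pose N := Num.trunc (e / `|t|).
have hM : M%:R * `|s| <= e := truncn_div_le (ltW e0) s0.
have hN : N%:R * `|t| <= e := truncn_div_le (ltW e0) t0.
have hM1 : e < M.+1%:R * `|s| by rewrite -ltr_pdivrMr// truncnS_gt.
have hN1 : e < N.+1%:R * `|t| by rewrite -ltr_pdivrMr// truncnS_gt.
have qMN : (q < M.+1 * N.+1)%N.
  rewrite -(ltr_nat R) natrM -(ltr_pM2r (mulr_gt0 s0 t0)).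
  apply: lt_trans qst _; rewrite [ltRHS]mulrACA.
  by apply: ltr_pM => //; exact: ltW.
have [M0 [N0 [hM0 hN0 qMN0 hprod0]]] := trim_box q0 qMN.
have [m [n [z [mn hm hn hz]]]] := small_relation x y q0 qMN0.
exists m, n, z; split => //.
have hprod : (maxn 1 `|m| * maxn 1 `|n| <= q)%N.
  apply: leq_trans (leq_mul _ _ : _ <= maxn 1 M0 * maxn 1 N0)%N hprod0.
  - by rewrite geq_max leq_maxl (leq_trans hm) ?leq_maxr.
  - by rewrite geq_max leq_maxl (leq_trans hn) ?leq_maxr.
(* The relation [m x + n y = z q] cancels the integer parts; the remaining factor [1 / q] pays for
   the product of the sides. *)
have -> : m%:~R * a + n%:~R * b - z%:~R = (m%:~R * s + n%:~R * t) / q%:R.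
  apply: (mulIf (lt0r_neq0 qR0)); rewrite divfK ?lt0r_neq0//.
  have : (m * x + n * y)%:~R = (z * q%:Z)%:~R :> R by rewrite hz.
  rewrite intrD !intrM -[(q%:Z)%:~R]pmulrn /s /t => h.
  transitivity (m%:~R * (q%:R * a) + n%:~R * (q%:R * b) - z%:~R * q%:R); first by ring.
  by rewrite -h; ring.
have hmn : `|m%:~R * s + n%:~R * t| <= eta.
  apply: le_trans (ler_normD _ _) _; rewrite !normrM -!intr_norm.
  have hm' : (`|m|%:~R * `|s| <= e :> R).
    apply: le_trans hM; rewrite ler_pM2r// -natr_absz ler_nat.
    exact: leq_trans hm hM0.
  have hn' : (`|n|%:~R * `|t| <= e :> R).
    apply: le_trans hN; rewrite ler_pM2r// -natr_absz ler_nat.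
    exact: leq_trans hn hN0.
  by rewrite /e in hm' hn'; lra.
rewrite normrM normfV (gtr0_norm qR0) -natrM mulrCA.
have h : (maxn 1 `|m| * maxn 1 `|n|)%:R / q%:R <= 1 :> R.
  by rewrite ler_pdivrMr// mul1r ler_nat.
apply: le_trans (_ : _ <= `|m%:~R * s + n%:~R * t| * 1) _; last by rewrite mulr1.
by rewrite ler_wpM2l.
Qed.

End LittlewoodDual.

(** * Phases of linear forms *)

Section Combinatorics.
Variable R : realType.

Definition rational (x : R) : Prop :=
  exists2 D : nat, (0 < D)%N & D%:R * x \is a Num.int.

Lemma common_denominator (T : finType) (P : pred T) (f : T -> R) :
  (forall t, P t -> rational (f t)) ->
  exists2 D : nat, (0 < D)%N & forall t, P t -> D%:R * f t \is a Num.int.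
Proof.
move=> h.
have /choice[g hg] : forall t, exists D : nat, (0 < D)%N /\
    (P t -> D%:R * f t \is a Num.int).
  move=> t; case: (boolP (P t)) => [/h[D D0 hD]|]; first by exists D.
  by exists 1%N.
exists (\prod_t g t)%N.
  by rewrite prodn_gt0// => t; case: (hg t).
move=> t Pt; rewrite (bigD1 t)//= mulnC natrM -mulrA rpredM ?natr_int//.
by case: (hg t) => _; exact.
Qed.

Lemma fpart_mul_inj (x : R) : ~ rational x ->
  injective (fun t : nat => fpart (t%:R * x)).
Proof.
move=> hx.
suff hlt s t : (s < t)%N -> fpart (s%:R * x) != fpart (t%:R * x).
  move=> s t /eqP; case: (ltngtP s t) => // st.
    by rewrite (negbTE (hlt _ _ st)).
  by rewrite eq_sym (negbTE (hlt _ _ st)).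
move=> st; apply/negP; rewrite eq_sym => /fpart_eqP[z hz]; apply: hx.
exists (t - s)%N; first by rewrite subn_gt0.
by rewrite natrB 1?ltnW// mulrBl hz addrAC subrr add0r intr_int.
Qed.

Lemma finite_pos_lb (T : finType) (f : T -> R) : (forall t, 0 < f t) ->
  exists2 e, 0 < e & forall t, e <= f t.
Proof.
move=> h; exists (\big[Num.min/1]_t f t); last by move=> t; exact: bigmin_le.
by apply: lt_bigmin => //; exact: ltr01.
Qed.

(** The points [fpart (s%:R * x)] with [s <= N] are distinct and cut [0, 1) into [N + 1] cells. Each
    [tau t] lies just to the right of the [t]-th cut point, so the comparisons at any number
    [e]-close to it recover [t]. *)
Lemma spread_targets (x : R) (N : nat) : ~ rational x ->
  exists (tau : nat -> R) (e : R), [/\ 0 < e,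
    (forall t, (t <= N)%N -> 0 < tau t < 1) &
    forall t t' w w', (t <= N)%N -> (t' <= N)%N ->
      `|w - tau t| < e -> `|w' - tau t'| < e ->
      (forall s, (s <= N)%N ->
        (fpart (s%:R * x) <= w) = (fpart (s%:R * x) <= w')) -> t = t'].
Proof.
move=> /fpart_mul_inj hx; pose p t := fpart (t%:R * x).
(* The distances between cut points, and on the diagonal the distance to the right end 1. *)
pose f (st : 'I_N.+1 * 'I_N.+1) :=
  if st.1 == st.2 then 1 - p st.1 else `|p st.1 - p st.2|.
have [|e e0 he] := @finite_pos_lb _ f.
  move=> [s t]; rewrite /f /=; case: eqP => [_|hst].
    by rewrite subr_gt0; case/andP: (fpart_itv (s%:R * x)).
  by rewrite normr_gt0 subr_eq0; apply/eqP => /hx /val_inj.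
have hst s t : (s <= N)%N -> (t <= N)%N -> p s < p t -> e <= p t - p s.
  move=> hs ht st; have := he (Ordinal (n := N.+1) ht, Ordinal (n := N.+1) hs).
  rewrite /f /= -val_eqE /=; case: eqP => [tsE|_].
    by rewrite tsE ltxx in st.
  by rewrite gtr0_norm// subr_gt0.
have h1 t : (t <= N)%N -> e <= 1 - p t.
  by move=> ht; have := he (Ordinal (n := N.+1) ht, Ordinal (n := N.+1) ht);
     rewrite /f /= eqxx.
(* A number within [e / 3] of this target is above [p t] and below [p t + e], hence before the next
   cut point. *)
exists (fun t => p t + e / 3), (e / 3); split; first by lra.
  move=> t ht; have /andP[h0 _] := fpart_itv (t%:R * x); have := h1 _ ht.
  by rewrite /p in h0 *; move=> h; apply/andP; split; lra.
have main t t' w w' : (t <= N)%N -> (t' <= N)%N ->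
    `|w - (p t + e / 3)| < e / 3 -> `|w' - (p t' + e / 3)| < e / 3 ->
    (forall s, (s <= N)%N -> (p s <= w) = (p s <= w')) -> ~ (p t < p t').
  move=> ht ht'; rewrite !ltr_norml => /andP[w1 w2] /andP[w3 w4] hs tt'.
  have := hst _ _ ht ht' tt' => hh.
  have : (p t' <= w) = true by rewrite hs//; lra.
  by move=> ?; lra.
move=> t t' w w' ht ht' hw hw' hs; apply: hx; apply/eqP.
rewrite -[_ == _]negbK neq_lt; apply/negP => /orP[].
  exact: (main t t' w w').
by apply: (main t' t w' w) => // s hs'; rewrite hs.
Qed.

(* Tile a large cube by cubes of side [rho] and count the points
   [n x - t v], which are pairwise distinct and stay close to that cube. *)
Lemma tile_count (d rho N : nat) (v : 'rV[int]_d)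
    (n : 'rV[int]_d -> 'rV[int]_d) :
  (forall (x : 'rV_d) j, x 0 j <= n x 0 j < x 0 j + rho%:Z) ->
  (forall x x' t t', (t < N)%N -> (t' < N)%N ->
    n x - v *+ t = n x' - v *+ t' -> t = t') ->
  (N <= (3 * rho) ^ d)%N.
Proof.
(* With [G] tiles per side, no shift [v *+ t] exceeds the side [G * rho], so all [N * G ^ d] points
   lie in a cube of side [3 * (G * rho)]; the power of [G] cancels at the end. *)
move=> hn hinj; pose G := (N * \sum_j `|v 0%R j| + 1)%N.
have G0 : (0 < G)%N by rewrite /G addn1.
pose x (g : {ffun 'I_d -> 'I_G}) : 'rV[int]_d := \row_j (g j * rho)%:Z.
pose F (p : {ffun 'I_d -> 'I_G} * 'I_N) := n (x p.1) - v *+ p.2.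
have rho0 (j : 'I_d) : (0 < rho)%N by have := hn 0 j; rewrite mxE; lia.
have hv (t : nat) j : (t <= N)%N -> (`|v 0%R j| * t <= G * rho)%N.
  move=> tN; apply: (@leq_trans G); last by rewrite leq_pmulr// (rho0 j).
  by rewrite /G mulnC (leq_trans _ (leq_addr _ _))// leq_mul// (bigD1 j)//= leq_addr.
have arith (a r g : nat) (y z : int) : (a + r <= g)%N -> (absz z <= g)%N ->
    a%:Z <= y < a%:Z + r%:Z ->
    0 <= y - z + g%:Z /\ (absz (y - z + g%:Z)%R < 3 * g)%N.
  by move=> h1 h2 h3; split; lia.
have hF0 p j : 0 <= F p 0 j + (G * rho)%:Z /\
    (absz (F p 0%R j + (G * rho)%:Z)%R < 3 * (G * rho))%N.
  rewrite /F !mxE mulmxnE; apply: (@arith (p.1 j * rho)%N rho).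
  - by rewrite addnC -mulSn leq_mul2r ltn_ord orbT.
  - by rewrite -mulr_natr natz abszM; apply: hv; exact: ltnW (ltn_ord _).
  - by have := hn (x p.1) j; rewrite mxE.
have hF p j := (hF0 p j).2; have hF' p j := (hF0 p j).1.
pose f p : {ffun 'I_d -> 'I_(3 * (G * rho))} := [ffun j => Ordinal (hF p j)].
have finj : injective f.
  move=> p q /ffunP fpq.
  have Fpq : F p = F q.
    apply/rowP => j; have := congr1 val (fpq j); rewrite !ffunE /=.
    move=> h; apply: (addIr (G * rho)%:Z).
    by rewrite -(gez0_abs (hF' p j)) -(gez0_abs (hF' q j)) h.
  have tE : p.2 = q.2 by apply: val_inj; exact: hinj Fpq.
  have : n (x p.1) = n (x q.1).
    by move: Fpq; rewrite /F tE => /addIr.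
  case: p q tE {fpq Fpq} => [g t] [g' t'] /= -> /rowP gg; congr pair.
  apply/ffunP => j; apply: val_inj => /=.
  have := hn (x g) j; have := hn (x g') j; rewrite gg !mxE.
  move: (n _ 0 j) => y h1 h2.
  have h3 : (g' j * rho < (g j).+1 * rho)%N.
    by rewrite mulSn; move: (g' j * rho)%N (g j * rho)%N h1 h2; lia.
  have h4 : (g j * rho < (g' j).+1 * rho)%N.
    by rewrite mulSn; move: (g' j * rho)%N (g j * rho)%N h1 h2 {h3}; lia.
  by move: h3 h4; rewrite !ltn_mul2r => /andP[_ h3] /andP[_ h4]; lia.
have := leq_card f finj.
rewrite card_prod !card_ffun !card_ord mulnCA expnMn.
by rewrite leq_pmul2l// expn_gt0 G0.
Qed.

End Combinatorics.

(** * Recurrence and density of the phases, and their conflict with the Littlewood conjecture *)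

Section LinearForms.
Variables (R : realType) (d c : nat) (A : 'M[R]_(d, c)) (sigma : 'rV[R]_c).

Definition form (n : 'rV[int]_d) (i : 'I_c) : R :=
  \sum_j (n 0 j)%:~R * A j i.

Definition phase (n : 'rV[int]_d) (i : 'I_c) : R :=
  fpart (sigma 0 i - form n i).

(* Points with the same phases, relative to the thresholds [fpart (form m i)]
   with [m] in a box, are the centers of equivalent patches of that shape. *)
Definition box_recurrent : Prop := exists2 K : R, 0 < K &
  forall a b : 'rV[int]_d, (forall j, a 0 j < b 0 j) ->
  exists2 rho : nat, (rho ^ d)%:R <= K * \prod_j (b 0 j - a 0 j)%:~R &
  forall n0 x : 'rV[int]_d, exists2 n1 : 'rV[int]_d,
    (forall j, x 0 j <= n1 0 j < x 0 j + rho%:Z) &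
    forall m : 'rV[int]_d, (forall j, a 0 j <= m 0 j <= b 0 j) ->
      forall i, (fpart (form m i) <= phase n1 i) = (fpart (form m i) <= phase n0 i).

Definition phase_dense : Prop := forall (tau : 'I_c -> R) (e : R), 0 < e ->
  (forall i, 0 < tau i < 1) -> exists n, forall i, `|phase n i - tau i| < e.

Definition form_aperiodic : Prop :=
  forall n, (forall i, form n i \is a Num.int) -> n = 0.

Lemma formB n m i : form (n - m) i = form n i - form m i.
Proof.
by rewrite /form -sumrB; apply: eq_bigr => j _; rewrite !mxE intrB mulrBl.
Qed.

Lemma formN n i : form (- n) i = - form n i.
Proof.
by rewrite /form -sumrN; apply: eq_bigr => j _; rewrite !mxE intrN mulNr.
Qed.

Lemma formMn n t i : form (n *+ t) i = t%:R * form n i.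
Proof.
rewrite /form mulr_sumr; apply: eq_bigr => j _.
by rewrite mulmxnE -[n 0 j *+ t]mulr_natr natz intrM -pmulrn; ring.
Qed.

Lemma phase_itv n i : 0 <= phase n i < 1.
Proof. exact: fpart_itv. Qed.

Lemma phaseBMn n v t i :
  phase (n - v *+ t) i = fpart (phase n i + t%:R * fpart (form v i)).
Proof.
apply/eqP/fpart_eqP; rewrite formB formMn /phase.
exists (Num.floor (sigma 0 i - form n i) + t%:Z * Num.floor (form v i)).
rewrite intrD intrM -pmulrn; set x := sigma 0 i - form n i.
have -> : sigma 0 i - (form n i - t%:R * form v i) = x + t%:R * form v i.
  by rewrite /x; ring.
by rewrite {1}(fpartE x) {1}(fpartE (form v i)); ring.
Qed.

Lemma phaseDMn n v t i :
  phase (n + v *+ t) i = fpart (phase n i - t%:R * fpart (form v i)).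
Proof.
apply/eqP/fpart_eqP; rewrite -[v *+ t]opprK formB formN formMn /phase.
exists (Num.floor (sigma 0 i - form n i) - t%:Z * Num.floor (form v i)).
rewrite intrB intrM -pmulrn; set x := sigma 0 i - form n i.
have -> : sigma 0 i - (form n i - - (t%:R * form v i)) = x - t%:R * form v i.
  by rewrite /x; ring.
by rewrite {1}(fpartE x) {1}(fpartE (form v i)); ring.
Qed.

(** Put [f = fpart (form v i)]. Every cube of side [rho] has a point with phase in [0, f), and the
    shift by [- v *+ t] moves this phase into [t f, (t + 1) f). For [t < N], with [N] about [1 / f],
    the shifts are told apart, so [tile_count] bounds [1 / f] by a multiple of [rho ^ d]. *)
Lemma recurrent_bad (i : 'I_c) : box_recurrent -> exists2 k : R, 0 < k &
  forall v, form v i \isn't a Num.int ->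
    k <= fpart (form v i) * \prod_j (maxn 1 `|v 0%R j|)%:R.
Proof.
(* The factors come from [1 / f < N + 1 <= 2 N], from [tile_count], from the recurrence, and from
   box sides of at most [2 max(1, |v_j|)]. *)
case=> K K0 hK; pose k := 2 * 3 ^+ d * K * 2 ^+ d.
have k0 : 0 < k by rewrite !mulr_gt0// exprn_gt0.
exists k^-1; first by rewrite invr_gt0.
move=> v; rewrite -fpart_eq0 => f0.
set f := fpart (form v i) in f0 *; have /andP[fge0 flt1] := fpart_itv (form v i).
rewrite -/f in fge0 flt1; have {fge0} {}f0 : 0 < f by rewrite lt_def f0.
(* The box holds 0 and [v]; the maximum with 1 keeps every side positive even where [v] vanishes. *)
pose a : 'rV[int]_d := \row_j Num.min (v 0 j) 0.
pose b : 'rV[int]_d := \row_j Num.max (v 0 j) 1.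
have [|rho hrho hrec] := hK a b; first by move=> j; rewrite !mxE; lia.
(* Each step by [v] lowers the phase by [f]; as many steps as fit without wrapping leave a remainder
   below [f]. *)
pose n0 := v *+ Num.trunc (phase 0 i / f).
have hn0 : phase n0 i < f.
  have /andP[p0 p1] := phase_itv 0 i; set p := phase 0 i in p0 p1.
  have h1 := truncn_div_le p0 f0.
  have h2 : p < (Num.trunc (p / f)).+1%:R * f by rewrite -ltr_pdivrMr ?truncnS_gt.
  rewrite -addn1 natrD mulrDl mul1r in h2.
  rewrite -[n0]add0r phaseDMn -/f -/p fpart_small; first by lra.
  by apply/andP; split; lra.
have /choice[n1 hn1] : forall x : 'rV[int]_d, exists n1 : 'rV[int]_d,
    (forall j, x 0 j <= n1 0 j < x 0 j + rho%:Z) /\ phase n1 i < f.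
  move=> x; have [n1 h1 h2] := hrec n0 x; exists n1; split => //.
  have := h2 v; rewrite -/f => /(_ _ i); rewrite -/f => h3.
  rewrite ltNge h3 -?ltNge//.
  by move=> j; rewrite !mxE; lia.
pose N := Num.trunc f^-1.
have hN1 : f^-1 < N.+1%:R := truncnS_gt _.
have hN : N%:R * f <= 1 by rewrite /N -div1r truncn_div_le.
have N0 : (0 < N)%N by rewrite truncn_gt0 invf_ge1// ltW.
have hcount : (N <= (3 * rho) ^ d)%N.
  apply: (@tile_count _ _ _ v n1); first by move=> x; case: (hn1 x).
  move=> x x' t t' tN t'N e.
  have hp y s : (s < N)%N -> phase (n1 y - v *+ s) i = phase (n1 y) i + s%:R * f.
    move=> sN; rewrite phaseBMn -/f fpart_small//.
    have [_ h] := hn1 y; have /andP[h0 _] := phase_itv (n1 y) i.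
    have : (s.+1)%:R * f <= N%:R * f by rewrite ler_pM2r// ler_nat.
    rewrite -addn1 natrD mulrDl mul1r => h'.
    have : 0 <= s%:R * f by rewrite mulr_ge0// ltW.
    by move=> ?; apply/andP; split; lra.
  have := hp x t tN; rewrite e hp// => hE.
  have [_ h] := hn1 x; have /andP[h0 _] := phase_itv (n1 x) i.
  have [_ h'] := hn1 x'; have /andP[h0' _] := phase_itv (n1 x') i.
  have hlt s s' p p' : 0 <= p -> p' < f -> p + s%:R * f = p' + s'%:R * f ->
      (s <= s')%N.
    move=> ? ? ?; rewrite leqNgt; apply/negP => s's.
    have : s'.+1%:R * f <= s%:R * f by rewrite ler_pM2r// ler_nat.
    by rewrite -addn1 natrD mulrDl mul1r; lra.
  by apply/eqP; rewrite eqn_leq (hlt _ _ _ _ h0 h' (esym hE)) (hlt _ _ _ _ h0' h hE).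
have hprod : \prod_j (b 0 j - a 0 j)%:~R <=
    2 ^+ d * \prod_j (maxn 1 `|v 0%R j|)%:R :> R.
  rewrite -[d in 2 ^+ d]card_ord -prodr_const -big_split/=.
  apply: ler_prod => j _; rewrite !mxE -natrM pmulrn ler_int ler0z.
  by apply/andP; split; lia.
rewrite -[k^-1]mulr1 ler_pdivrMl// mulrCA -ler_pdivrMl// mulr1.
apply: le_trans (ltW hN1) _.
apply: (@le_trans _ _ (2 * N%:R)); first by rewrite -natrM ler_nat; lia.
rewrite /k -!mulrA ler_pM2l//.
apply: (@le_trans _ _ (3 ^+ d * (rho ^ d)%:R)).
  by rewrite -natrX -natrM -expnMn ler_nat.
rewrite ler_pM2l ?exprn_gt0//.
apply: le_trans hrho _.
by rewrite ler_pM2l.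
Qed.

Lemma form_delta j (z : int) i : form (z *: delta_mx 0 j) i = z%:~R * A j i.
Proof.
rewrite /form (bigD1 j)//= big1 => [|l lj].
  by rewrite !mxE !eqxx mulr1 addr0.
by rewrite !mxE (negbTE lj) andbF mulr0 mul0r.
Qed.

(** The box has side [N] along [j] and 1 elsewhere, so its volume is [N]; only multiples of the
    [j]-th basis vector serve as thresholds. The points found in the cube at the origin are encoded
    in a finite type in order to be counted, with [rho] independent of [n0]. *)
Lemma recurrent_axis (j : 'I_d) : box_recurrent ->
  exists2 K : R, 0 < K & forall N : nat, (0 < N)%N ->
  exists2 rho : nat, (rho ^ d)%:R <= K * N%:R &
  forall n0, exists2 g : {ffun 'I_d -> 'I_rho},
    True & forall i s, (s <= N)%N ->
      (fpart (s%:R * A j i) <= phase (\row_l (g l : nat)%:Z) i) =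
      (fpart (s%:R * A j i) <= phase n0 i).
Proof.
case=> K K0 hK; exists K => // N N0.
have [|rho hrho h] := hK 0 (\row_l (if l == j then N else 1%N)%:Z).
  by move=> l; rewrite !mxE; case: eqP; lia.
exists rho.
  apply: le_trans hrho _; rewrite (bigD1 j)//= big1 => [|l lj].
    by rewrite !mxE eqxx subr0 mulr1 -pmulrn.
  by rewrite !mxE (negbTE lj) subr0.
move=> n0; have [n1 h1 h2] := h n0 0.
have hlt l : (`|n1 0%R l| < rho)%N by have := h1 l; rewrite mxE; lia.
exists [ffun l => Ordinal (hlt l)] => // i s sN.
have -> : \row_l (([ffun l0 => Ordinal (hlt l0)] l : nat)%:Z) = n1.
  by apply/rowP => l; rewrite mxE ffunE /= gez0_abs//; have := h1 l; rewrite mxE; lia.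
have := h2 (s%:Z *: delta_mx 0 j) _ i; rewrite form_delta -pmulrn; apply => l.
by rewrite !mxE; case: eqP => _ /=; rewrite ?mulr1 ?mulr0; lia.
Qed.

Lemma archi_sq (K : R) : 0 < K -> exists2 N : nat, (0 < N)%N &
  K * N%:R < (N.+1 ^ 2)%:R.
Proof.
move=> K0; exists (Num.trunc K).+1 => //.
have := truncnS_gt K; set n := _.+1 => h.
apply: (@lt_le_trans _ _ (n%:R * n%:R)); first by rewrite ltr_pM2r// ltr0n.
by rewrite -natrM ler_nat -mulnn leq_mul.
Qed.

(* The [(N + 1)^2] cells cut out by the two forms exceed the [O(N)] points of
   the ball. *)
Lemma irrational_unique (j : 'I_d) (i i' : 'I_c) :
  box_recurrent -> phase_dense ->
  ~ rational (A j i) -> ~ rational (A j i') -> i = i'.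
Proof.
move=> hR hd hi hi'; apply/eqP; apply: contrapT => /negP ii'.
have [K K0 hK] := recurrent_axis j hR.
have [N N0 hN] := archi_sq K0; have [rho hrho hg] := hK N N0.
have [tau [e [e0 htau hsep]]] := spread_targets N hi.
have [tau' [e' [e0' htau' hsep']]] := spread_targets N hi'.
have /choice[f hf] : forall p : 'I_N.+1 * 'I_N.+1,
    exists g : {ffun 'I_d -> 'I_rho}, exists w w' : R,
    [/\ `|w - tau p.1| < e, `|w' - tau' p.2| < e',
     forall s, (s <= N)%N ->
       (fpart (s%:R * A j i) <= phase (\row_l (g l : nat)%:Z) i) =
       (fpart (s%:R * A j i) <= w) &
     forall s, (s <= N)%N ->
       (fpart (s%:R * A j i') <= phase (\row_l (g l : nat)%:Z) i') =
       (fpart (s%:R * A j i') <= w')].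
  case=> t t' /=; have tN : (t <= N)%N by rewrite -ltnS.
  have tN' : (t' <= N)%N by rewrite -ltnS.
  (* As [i] and [i'] differ, density realises every pair of cells at once; the other phases are
     aimed at an arbitrary interior value. *)
  pose T k := if k == i then tau t else if k == i' then tau' t' else 1 / 2.
  have [||n0 hn0] := hd T (Num.min e e').
  - by rewrite lt_min e0.
  - move=> k; rewrite /T; case: eqP => _; first exact: htau.
    by case: eqP => _; [exact: htau' | lra].
  have [g _ hg'] := hg n0; exists g, (phase n0 i), (phase n0 i'); split => //.
  - by have := hn0 i; rewrite /T eqxx lt_min => /andP[].
  - by have := hn0 i'; rewrite /T eq_sym (negbTE ii') eqxx lt_min => /andP[].
  - by move=> s; exact: hg'.
  - by move=> s; exact: hg'.
have finj : injective f.
  move=> [t t'] [u u'] tu.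
  have [w1 [w1' [/= a1 a2 a3 a4]]] := hf (t, t').
  have [w2 [w2' [/= b1 b2 b3 b4]]] := hf (u, u').
  congr pair; apply: val_inj => /=.
    apply: (hsep _ _ w1 w2) => //; rewrite -1?ltnS// => s sN.
    by rewrite -a3// -b3// tu.
  apply: (hsep' _ _ w1' w2') => //; rewrite -1?ltnS// => s sN.
  by rewrite -a4// -b4// tu.
have := leq_card f finj.
rewrite card_prod card_ffun !card_ord mulnn -(ler_nat R) => h.
by have := lt_le_trans hN (le_trans h hrho); rewrite ltxx.
Qed.

(* If only one coefficient of a form is irrational, then in a cube of side
   [rho] the form takes [O(rho)] values modulo 1, fewer than the [N + 1] cells,
   where [N] is of order [rho ^ d]. *)
Lemma irrational_second (j : 'I_d) (i : 'I_c) : (1 < d)%N ->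
  box_recurrent -> phase_dense -> ~ rational (A j i) ->
  exists2 l, l != j & ~ rational (A l i).
Proof.
move=> d1 hR hd hi; apply: contrapT => hno.
have [D D0 hD] : exists2 D : nat, (0 < D)%N &
    forall l, l != j -> D%:R * A l i \is a Num.int.
  by apply: common_denominator => l lj; apply: contrapT => ?; apply: hno; exists l.
have [K K0 hK] := recurrent_axis j hR.
have [|N N0 hN] := @archi_sq (K * (D ^ 2)%:R).
  by rewrite mulr_gt0// ltr0n expn_gt0 D0.
have [rho hrho hg] := hK N N0.
have [tau [e [e0 htau hsep]]] := spread_targets N hi.
have /choice[f hf] : forall t : 'I_N.+1,
    exists g : {ffun 'I_d -> 'I_rho}, exists w : R,
    `|w - tau t| < e /\
     forall s, (s <= N)%N ->
       (fpart (s%:R * A j i) <= phase (\row_l (g l : nat)%:Z) i) =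
       (fpart (s%:R * A j i) <= w).
  move=> t; have tN : (t <= N)%N by rewrite -ltnS.
  have [//||n0 hn0] := hd (fun=> tau t) e; first by move=> k; exact: htau.
  have [g _ hg'] := hg n0; exists g, (phase n0 i); split => // s.
  exact: hg'.
(* The contribution of the rational coefficients modulo 1, a multiple of [1 / D]; with [g j] it
   determines the phase, hence the cell. *)
pose z (g : {ffun 'I_d -> 'I_rho}) := fpart (\sum_(l | l != j) (g l : nat)%:R * A l i).
have zD g : exists2 k : nat, (k < D)%N & D%:R * z g = k%:R.
  have /andP[z0 z1] := fpart_itv (\sum_(l | l != j) (g l : nat)%:R * A l i).
  rewrite -/(z g) in z0 z1.
  have : D%:R * z g \is a Num.int.
    rewrite /z /fpart mulrBr rpredB//; last by rewrite rpredM ?natr_int ?intr_int.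
    rewrite mulr_sumr rpred_sum// => l lj.
    by rewrite mulrCA rpredM ?natr_int// hD.
  move/intrP => [m hm].
  have m0 : 0 <= m by rewrite -(ler0z R) -hm mulr_ge0.
  exists `|m|%N; last by rewrite natr_absz ger0_norm.
  have : (m < D%:Z)%R by rewrite -(ltr_int R) -hm -pmulrn gtr_pMr// ltr0n.
  lia.
have /choice[r hr] : forall g, exists k : 'I_D, D%:R * z g = k%:R.
  by move=> g; have [k kD hk] := zD g; exists (Ordinal kD).
have hph (g g' : {ffun 'I_d -> 'I_rho}) : g j = g' j -> r g = r g' ->
    phase (\row_l (g l : nat)%:Z) i = phase (\row_l (g' l : nat)%:Z) i.
  move=> gj rg; have : z g = z g'.
    by apply: (mulfI (_ : D%:R != 0)); rewrite ?pnatr_eq0 -?lt0n// !hr rg.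
  move/eqP/fpart_eqP => [m hm]; apply/eqP/fpart_eqP; exists (- m).
  have hs (h : {ffun 'I_d -> 'I_rho}) : form (\row_l (h l : nat)%:Z) i =
      (h j : nat)%:R * A j i + \sum_(l | l != j) (h l : nat)%:R * A l i.
    rewrite /form (bigD1 j)//= mxE -pmulrn; congr +%R.
    by apply: eq_bigr => l _; rewrite mxE -pmulrn.
  by rewrite !hs hm gj intrN; ring.
have finj : injective (fun t => (f t j, r (f t))).
  move=> t u [tu1 tu2].
  have [w1 [a1 a2]] := hf t; have [w2 [b1 b2]] := hf u.
  apply: val_inj => /=; apply: (hsep _ _ w1 w2) => //; rewrite -1?ltnS// => s sN.
  by rewrite -a2// -b2// (hph (f t) (f u)).
have := leq_card _ finj; rewrite card_prod !card_ord => h.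
(* Here [1 < d] enters, through [rho ^ 2 <= rho ^ d]. *)
have {h} : (N.+1 ^ 2 <= rho ^ d * D ^ 2)%N.
  apply: (@leq_trans ((rho * D) ^ 2)); first by rewrite leq_exp2r.
  rewrite expnMn leq_mul2r; apply/orP; right.
  case: (posnP rho) h => [->//|rho0 _]; exact: leq_pexp2l.
rewrite -(ler_nat R) natrM => h.
have := lt_le_trans hN h; rewrite ltNge => /negP; apply.
by rewrite mulrAC ler_wpM2r.
Qed.

(** With a common denominator [D], any two [i]-th phases differ by a multiple of [u = 1 / D].
    Targets [u / 4] and [3 u / 4], each met within [u / 8], would force a difference strictly
    between 0 and [u]. *)
Lemma irrational_exists (i : 'I_c) : phase_dense ->
  exists l, ~ rational (A l i).
Proof.
move=> hd; apply: contrapT => hno.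
have [D D0 hD] : exists2 D : nat, (0 < D)%N &
    forall l, predT l -> D%:R * A l i \is a Num.int.
  by apply: common_denominator => l _; apply: contrapT => ?; apply: hno; exists l.
have D0R : (0 : R) < D%:R by rewrite ltr0n.
pose u : R := D%:R^-1.
have u0 : 0 < u by rewrite invr_gt0.
have u1 : u <= 1 by rewrite invf_le1// ler1n.
have [||n hn] := hd (fun=> u / 4) (u / 8); [lra| by move=> _; lra|].
have [||m hm] := hd (fun=> u * (3 / 4)) (u / 8); [lra| by move=> _; lra|].
have hint : D%:R * (phase m i - phase n i) \is a Num.int.
  have hf v : D%:R * form v i \is a Num.int.
    rewrite /form mulr_sumr rpred_sum// => l _.
    by rewrite mulrCA rpredM ?intr_int ?hD.
  rewrite /phase /fpart.
  set z1 := Num.floor _; set z2 := Num.floor _.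
  have -> : D%:R * (sigma 0 i - form m i - z1%:~R - (sigma 0 i - form n i - z2%:~R)) =
     D%:R * form n i - D%:R * form m i - D%:R * (z1 - z2)%:~R by rewrite intrB; ring.
  by rewrite !rpredB// rpredM ?natr_int ?intr_int.
move/intrP: hint => [z hz].
have {hn} := hn i; have {hm} := hm i; rewrite !ltr_norml => /andP[m1 m2] /andP[n1 n2].
have Du : D%:R * u = 1 by rewrite /u mulfV ?pnatr_eq0 -?lt0n.
have z0 : (0 : R) < z%:~R by rewrite -hz mulr_gt0//; lra.
have : (z%:~R : R) < 1.
  by rewrite -hz -[ltRHS]Du ltr_pM2l//; lra.
by move: z0; rewrite ltr0z -[1]/(1%:~R) ltr_int; lia.
Qed.

Lemma not_box_recurrent : (0 < d)%N -> (0 < c)%N -> (c, d) <> (1, 1)%N ->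
  littlewood R -> phase_dense -> form_aperiodic ->
  ~ box_recurrent.
Proof.
move=> d0 c0 cd hL hd ha hR; pose j := Ordinal d0.
(* Otherwise a multiple of the [j]-th basis vector would make all forms integral. *)
have [i hi] : exists i, ~ rational (A j i).
  apply: contrapT => hno.
  have [D D0 hD] : exists2 D : nat, (0 < D)%N &
      forall i, predT i -> D%:R * A j i \is a Num.int.
    by apply: common_denominator => i _; apply: contrapT => ?; apply: hno; exists i.
  have := ha (D%:Z *: delta_mx 0 j) => h.
  have /rowP/(_ j) : D%:Z *: delta_mx 0 j = 0 :> 'rV[int]_d.
    by apply: h => i; rewrite form_delta -pmulrn hD.
  by rewrite !mxE !eqxx mulr1 => /eqP; rewrite eqz_nat -leqn0 leqNgt D0.
(* For [d = 1] there are at least two forms, each irrational in the only coordinate, against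
   [irrational_unique]. *)
case: (ltnP 1 d) => [d1|d1]; last first.
  have c1 : (1 < c)%N.
    rewrite ltn_neqAle c0 andbT; apply/eqP => c1; apply: cd.
    by congr pair => //; apply/eqP; rewrite eqn_leq d1.
  have [i' ii'] : exists i' : 'I_c, i' != i.
    have [i0|i0] := eqVneq i (Ordinal c0).
      by exists (Ordinal c1); rewrite i0.
    by exists (Ordinal c0); rewrite eq_sym.
  have [l hl] := irrational_exists i' hd.
  have lj : l = j by apply: val_inj => /=; have := ltn_ord l; lia.
  rewrite lj in hl.
  by move/eqP: ii'; apply; apply: irrational_unique hl hi.
have [l lj hl] := irrational_second d1 hR hd hi.
have [k k0 hk] := recurrent_bad i hR.
pose eta := Num.min (k / 2) (1 / 2).
have eta0 : 0 < eta by rewrite lt_min; apply/andP; split; lra.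
have eta1 : eta < 1 by rewrite gt_min; apply/orP; right; lra.
have etak : eta < k by rewrite gt_min; apply/orP; left; lra.
have [m [n [z [mn hmn]]]] := littlewood_dual (A j i) (A l i) hL eta0 eta1.
pose v : 'rV[int]_d := m *: delta_mx 0 j + n *: delta_mx 0 l.
have vj : v 0 j = m by rewrite !mxE !eqxx eq_sym (negbTE lj) mulr1 mulr0 addr0.
have vl : v 0 l = n by rewrite !mxE !eqxx (negbTE lj) mulr1 mulr0 add0r.
have hv i' : form v i' = m%:~R * A j i' + n%:~R * A l i'.
  by rewrite /v -[n *: _]opprK formB formN opprK !form_delta.
have hprod (w : 'rV[int]_d) : w = v \/ w = - v ->
    \prod_j0 (maxn 1 `|w 0%R j0|)%:R =
    (maxn 1 `|m|)%:R * (maxn 1 `|n|)%:R :> R.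
  move=> hw; have hw' j0 : `|w 0%R j0|%N = `|v 0%R j0|%N.
    by case: hw => ->//; rewrite mxE abszN.
  rewrite (bigD1 j)//= (bigD1 l)//= big1 => [|j0 /andP[h1 h2]].
    by rewrite mulr1 !hw' vj vl.
  by rewrite hw' !mxE (negbTE h1) (negbTE h2) !mulr0 addr0.
(* By [irrational_unique] the other forms have rational coefficients at [j] and [l]. If form [i]
   were integral at [v], a multiple of [v] clearing these denominators would contradict
   aperiodicity. *)
have vint : form v i \isn't a Num.int.
  apply/negP => vint.
  have hD j0 : ~ rational (A j0 i) -> exists2 D : nat, (0 < D)%N &
      forall i', i' != i -> D%:R * A j0 i' \is a Num.int.
    move=> h0; apply: common_denominator => i' ii'; apply: contrapT => h.
    by move/eqP: ii'; apply; apply: irrational_unique h h0.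
  have [D D0 hDj] := hD j hi; have [E E0 hEl] := hD l hl.
  have : v *+ (D * E) = 0.
    apply: ha => i'; rewrite formMn; have [->|ii'] := eqVneq i' i.
      by rewrite rpredM ?natr_int.
    rewrite hv natrM.
    have -> : D%:R * E%:R * (m%:~R * A j i' + n%:~R * A l i') =
      E%:R * m%:~R * (D%:R * A j i') + D%:R * n%:~R * (E%:R * A l i') by ring.
    by apply: rpredD; apply: rpredM; rewrite ?hDj ?hEl// rpredM ?natr_int ?intr_int.
  move/rowP => h; have h0 j0 : v 0 j0 = 0.
    have := h j0; rewrite mulmxnE [RHS]mxE => /eqP.
    by rewrite mulrn_eq0 muln_eq0 (gtn_eqF D0) (gtn_eqF E0) => /eqP.
  by move: mn; rewrite -vj -vl !h0 eqxx.
set Q := (maxn 1 `|m|)%:R * (maxn 1 `|n|)%:R in hmn hprod.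
have Q1 : 1 <= Q.
  by rewrite /Q -natrM ler1n muln_gt0 !leq_max.
set x := m%:~R * A j i + n%:~R * A l i in hmn.
have hx : form v i = x by exact: hv.
(* [fpart] measures the distance to the integer below only; when [z] is above [x], the vector [- v]
   is used instead. *)
have [xz|xz] := lerP z%:~R x.
  have xz0 : 0 <= x - z%:~R by rewrite subr_ge0.
  rewrite ger0_norm// in hmn.
  have h1 : x - z%:~R < 1.
    by apply: le_lt_trans eta1; apply: le_trans hmn; rewrite ler_peMl.
  have h2 : fpart (form v i) = x - z%:~R.
    by rewrite hx; apply: (@fpart_uniq _ _ _ z); rewrite ?subrK ?xz0.
  have := hk v vint; rewrite h2 hprod; last by left.
  by rewrite mulrC => h; have := le_lt_trans (le_trans h hmn) etak; rewrite ltxx.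
have xz0 : 0 <= z%:~R - x by rewrite subr_ge0 ltW.
rewrite distrC ger0_norm// in hmn.
have h1 : z%:~R - x < 1.
  by apply: le_lt_trans eta1; apply: le_trans hmn; rewrite ler_peMl.
have h2 : fpart (form (- v) i) = z%:~R - x.
  rewrite formN hx; apply: (@fpart_uniq _ _ _ (- z)); rewrite ?xz0// intrN; ring.
have := hk (- v); rewrite formN rpredN => /(_ vint).
rewrite -formN h2 hprod; last by right.
by rewrite mulrC => h; have := le_lt_trans (le_trans h hmn) etak; rewrite ltxx.
Qed.

End LinearForms.

(** * Volume *)

Section Volume.
Variables (R : realType) (d : nat).
Implicit Types (a b : 'rV[R]_d) (U V : set 'rV[R]_d).

(** The product is a polynomial in [e], hence continuous at 0. *)
Lemma prodr_enlarge (l : 'I_d -> R) (eps : R) : 0 < eps ->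
  exists2 e : R, 0 < e & \prod_i (l i + e *+ 2) <= \prod_i l i + eps.
Proof.
move=> eps0; pose p : {poly R} := \prod_i ((l i)%:P + 'X *+ 2).
have pE x : p.[x] = \prod_i (l i + x *+ 2).
  by rewrite /p horner_prod; apply: eq_bigr => i _;
     rewrite hornerD hornerMn hornerC hornerX.
have /cvgrPdist_lt/(_ eps eps0) := @continuous_horner R p 0.
move=> /nbhs_ballP[r /= r0 hr].
have hr' : 0 < r / 2 by rewrite divr_gt0.
exists (r / 2) => //.
have : ball (0 : R) r (r / 2).
  by rewrite /ball /= sub0r normrN gtr0_norm//; lra.
move/hr; rewrite /= !pE ltr_norml => /andP[h _].
move: h; under [X in X - _]eq_bigr do rewrite mul0rn addr0.
lra.
Qed.

(** An interval of [L] mesh lengths holds at most [trunc L + 1] grid points, and this is at most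
    [2 L] once [L >= 1]. *)
Lemma card_int_points (N : nat) (y z : R) : 1 <= N%:R * (z - y) ->
  \sum_(j < N) (y < j%:R / N%:R < z)%R%:R <= 2 * (N%:R * (z - y)).
Proof.
move=> h; have N0 : (0 < N%:R :> R).
  by rewrite ltr0n lt0n; apply: contraL h => /eqP ->; rewrite mul0r -ltNge.
set L := N%:R * (z - y) in h *.
pose m := Num.floor (N%:R * y); pose M := (Num.trunc L).+1.
have hm := floor_le (N%:R * y); have hm1 := floorD1_gt (N%:R * y).
have hL := truncnS_gt L.
have hL' : (Num.trunc L)%:R <= L by rewrite truncn_le (le_trans ler01).
rewrite -/m in hm hm1; rewrite -/M in hL.
pose S := [set j : 'I_N | y < j%:R / N%:R < z]%SET.
have hS j : j \in S ->
    (absz ((j : nat)%:Z - (m + 1))%R < M)%N /\ 0 <= (j : nat)%:Z - (m + 1).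
  rewrite inE ltr_pdivlMr// ltr_pdivrMr// => /andP[h1 h2].
  have h3 : 0 <= (j : nat)%:Z - (m + 1).
    have : (m < (j : nat)%:Z)%R.
      by rewrite -(ltr_int R) -pmulrn (le_lt_trans hm)// mulrC.
    lia.
  split=> //; rewrite -ltz_nat gez0_abs// -(ltr_int R) intrB -!pmulrn.
  apply: le_lt_trans hL; rewrite /L mulrBr (mulrC _ z); lra.
pose f (j : 'I_N) : 'I_M := inord (absz ((j : nat)%:Z - (m + 1))%R).
have finj : {in S &, injective f}.
  move=> j j' /hS[h1 h2] /hS[h3 h4] /(congr1 val) /=; rewrite !inordK// => h5.
  by apply: val_inj => /=; lia.
have hcard : (#|S| <= M)%N.
  by rewrite -(card_in_imset finj) (leq_trans (max_card _))// card_ord.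
have -> : \sum_(j < N) (y < j%:R / N%:R < z)%R%:R = #|S|%:R :> R.
  by rewrite -sum1_card natr_sum [RHS]big_mkcond/=; apply: eq_bigr => j _;
     rewrite inE; case: ifP.
have : (#|S|%:R <= M%:R :> R) by rewrite ler_nat.
by rewrite /M -addn1 natrD; lra.
Qed.

Lemma open_box a b : open [set x : 'rV[R]_d | forall i, a 0 i < x 0 i < b 0 i].
Proof.
rewrite openE => x /= hx.
apply: (@filter_forall _ _
  (fun i (y : 'rV[R]_d) => a 0 i < y 0 i < b 0 i) (nbhs x) _) => i.
have h : \forall z \near x 0 i, z \in `]a 0 i, b 0 i[.
  by apply: near_in_itvoo; rewrite in_itv/= hx.
have {}h := @coord_continuous R 1 d 0 i x _ h.
by apply: (@filterS _ (nbhs x) _ _ _ _ h) => y /=; rewrite in_itv.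
Qed.

Lemma unit_cube_compact : compact (@rectangle R d 0 (const_mx 1)).
Proof.
have := @rV_compact R d (fun=> `[0, 1]%classic).
have -> : [set v : 'rV[R]_d | forall i, `[0, 1]%classic (v ord0 i)] =
    rectangle 0 (const_mx 1).
  by apply/seteqP; split => v /= h i; have := h i; rewrite !mxE /= in_itv.
by apply => i; exact: segment_compact.
Qed.

(** On a grid of mesh [1 / N] finer than every side, a box holds at most [(2 N) ^ d] times its
    volume in grid points, while together the boxes catch [N ^ d] of them. *)
Lemma box_cover_count (M : nat) (a b : nat -> 'rV[R]_d) :
  (forall n i, a n 0 i < b n 0 i) ->
  (forall x, rectangle 0 (const_mx 1) x ->
     exists2 n, (n < M)%N & forall i, a n 0 i < x 0 i < b n 0 i) ->
  (2 ^+ d)^-1 <= \sum_(n < M) \prod_i (b n 0 i - a n 0 i).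
Proof.
move=> hab hcov.
have [e e0 he] := @finite_pos_lb R ('I_M * 'I_d)%type
  (fun p => b p.1 0 p.2 - a p.1 0 p.2) (fun p => ltac:(by rewrite subr_gt0 hab)).
pose N := (Num.trunc e^-1).+1.
have N0 : (0 < N%:R :> R) by rewrite ltr0n.
have hN (n : 'I_M) i : 1 <= N%:R * (b n 0 i - a n 0 i).
  have := he (n, i) => /= h; apply: (@le_trans _ _ (N%:R * e)).
    by rewrite -ler_pdivrMr// div1r ltW// truncnS_gt.
  by rewrite ler_pM2l.
(* The indicator of a box is a product over coordinates, so its sum over the grid factors by
   distributivity. *)
pose F (n : 'I_M) i (j : 'I_N) : R := (a n 0 i < j%:R / N%:R < b n 0 i)%R%:R.
have h1 (g : {ffun 'I_d -> 'I_N}) : 1 <= \sum_(n < M) \prod_i F n i (g i).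
  have [|n nM hn] := hcov (\row_i ((g i)%:R / N%:R)).
    move=> i; rewrite !mxE; apply/andP; split; first by rewrite divr_ge0.
    by rewrite ler_pdivrMr// mul1r ler_nat ltnW.
  rewrite (bigD1 (Ordinal nM))//= [X in X + _]big1 => [|i _].
    by rewrite lerDl sumr_ge0// => m _; rewrite prodr_ge0.
  by have := hn i; rewrite mxE /F /= => ->.
have : \sum_(g : {ffun 'I_d -> 'I_N}) 1 <=
    \sum_(g : {ffun 'I_d -> 'I_N}) \sum_(n < M) \prod_i F n i (g i) :> R.
  by apply: ler_sum.
have hF n : \sum_(g : {ffun 'I_d -> 'I_N}) \prod_i F n i (g i) =
    \prod_i \sum_j F n i j by rewrite bigA_distr_bigA.
rewrite exchange_big/= (eq_bigr _ (fun n _ => hF n)).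
rewrite sumr_const card_ffun !card_ord natrX => h2.
have h3 : N%:R ^+ d <= \sum_(n < M) \prod_(i < d) (2 * N%:R * (b n 0 i - a n 0 i)) :> R.
  apply: le_trans h2 _; apply: ler_sum => n _; apply: ler_prod => i _.
  rewrite sumr_ge0//= /F -mulrA; exact: card_int_points.
have hp (n : 'I_M) : \prod_(i < d) (2 * N%:R * (b n 0 i - a n 0 i)) =
    (2 * N%:R) ^+ d * \prod_i (b n 0 i - a n 0 i).
  by rewrite big_split/= prodr_const card_ord.
move: h3; rewrite (eq_bigr _ (fun n _ => hp n)) -mulr_sumr exprMn mulrAC.
rewrite -ler_pdivrMr ?exprn_gt0//.
rewrite divff ?lt0r_neq0 ?exprn_gt0// => h3.
by rewrite -[leLHS]mulr1 ler_pdivrMl ?exprn_gt0.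
Qed.

(** Opening the [n]-th box of a cover at cost [eps / 2 ^ (n + 1)] makes compactness applicable; the
    finite subcover is handled by [box_cover_count]. *)
Lemma volume_unit_cube :
  (((2 ^+ d)^-1)%:E <= volume (@rectangle R d 0%R (const_mx 1%R)))%E.
Proof.
apply: le_ereal_inf_tmp => _ [a [b [hab hcov ->]]].
apply/lee_addgt0Pr => eps eps0.
have /choice[e he] : forall n, exists e : R, 0 < e /\
    \prod_i (b n 0 i - a n 0 i + e *+ 2) <=
    \prod_i (b n 0 i - a n 0 i) + eps / (2 ^ n.+1)%:R.
  move=> n; have [|e e0 h] := @prodr_enlarge (fun i => b n 0 i - a n 0 i)
    (eps / (2 ^ n.+1)%:R).
    by rewrite divr_gt0// ltr0n expn_gt0.
  by exists e.
pose a' n := a n - const_mx (e n); pose b' n := b n + const_mx (e n).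
have := unit_cube_compact; rewrite compact_cover.
move=> /(_ _ setT (fun n =>
  [set x : 'rV[R]_d | forall i, a' n 0 i < x 0 i < b' n 0 i])).
case=> [n _|x /hcov[n _ hn]|D _ hD].
- exact: open_box.
- exists n => //= i; have := hn i; rewrite !mxE => /andP[h1 h2].
  by have [h _] := he n; apply/andP; split; lra.
pose M := (\max_(n <- finmap.enum_fset D) n).+1.
have hM : forall x, rectangle 0 (const_mx 1) x ->
     exists2 n, (n < M)%N & forall i, a' n 0 i < x 0 i < b' n 0 i.
  move=> x /hD[n /= nD hn]; exists n => //.
  by rewrite /M ltnS; exact: (@leq_bigmax_seq _ (finmap.enum_fset D) xpredT id n).
have hab' n i : a' n 0 i < b' n 0 i.
  by rewrite !mxE; have [? _] := he n; have := hab n i; lra.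
have h := box_cover_count hab' hM.
have pos n : (0%E <= (\prod_(i < d) (b n 0 i - a n 0 i))%:E :> \bar R)%E.
  by rewrite lee_fin prodr_ge0// => i _; rewrite subr_ge0.
apply: le_trans (epsilon_trick xpredT pos (ltW eps0)).
apply: le_trans (nneseries_lim_ge M _) => [|n _ _]; last first.
  by rewrite adde_ge0// lee_fin divr_ge0// ltW.
rewrite big_mkord; under eq_bigr do rewrite -EFinD.
rewrite sumEFin lee_fin; apply: le_trans h _; apply: ler_sum => n _.
have [_ h] := he n; apply: le_trans h.
by rewrite le_eqVlt; apply/orP; left; apply/eqP; apply: eq_bigr => i _;
   rewrite !mxE; ring.
Qed.

Lemma volume_le U V : U `<=` V -> (volume U <= volume V)%E.
Proof.
move=> UV; apply: ereal_inf_le_tmp => _ [a [b [hab hV ->]]].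
by exists a, b; split => //; exact: subset_trans hV.
Qed.

Lemma volume_ge0 U : (0 <= volume U)%E.
Proof.
apply: le_ereal_inf_tmp => _ [a [b [hab hV ->]]].
apply: nneseries_ge0 => n _ _; rewrite lee_fin prodr_ge0// => i _.
by rewrite subr_ge0.
Qed.

Lemma volume_rectangle_le a b : (0 < d)%N -> (forall i, a 0 i <= b 0 i) ->
  (volume (rectangle a b) <= (\prod_i (b 0 i - a 0 i))%:E)%E.
Proof.
move=> d0 hab; apply: ge_ereal_inf.
(* After the rectangle itself, the cover repeats the single point [a], a box of volume 0 because
   [0 < d]. *)
exists (\sum_(0 <= n <oo) (\prod_(i < d)
  ((if n is 0%N then b else a) 0%R i - a 0%R i))%:E)%E.
  exists (fun=> a), (fun n => if n is 0%N then b else a); split => //.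
    by case.
  by move=> x hx; exists 0%N.
rewrite nneseries_recl//=; last first.
  by move=> [|n] _; rewrite lee_fin prodr_ge0// => i _; rewrite subr_ge0.
rewrite eseries0 ?adde0// => -[//|n] _ _.
by rewrite (bigD1 (Ordinal d0))//= subrr mul0r.
Qed.

Lemma volume_affine_le (l : R) (t : 'rV[R]_d) U : 0 < l ->
  (volume [set (l *: x + t)%R | x in U] <= (l ^+ d)%:E * volume U)%E.
Proof.
move=> l0; rewrite /volume -ereal_inf_pZl ?exprn_gt0//.
apply: ereal_inf_le_tmp => _ [_ [a [b [hab hU ->]]] <-].
exists (fun n => l *: a n + t), (fun n => l *: b n + t); split.
- by move=> n i; rewrite !mxE lerD2r ler_pM2l.
- move=> _ [x /hU[n _ hn] <-]; exists n => // i; rewrite !mxE.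
  by rewrite !lerD2r !ler_pM2l.
- rewrite -nneseriesZl; last first.
    by move=> n _; rewrite lee_fin prodr_ge0// => i _; rewrite subr_ge0.
  apply: eq_eseriesr => n _; rewrite -EFinM; congr EFin.
  rewrite -[d in l ^+ d]card_ord -prodr_const -big_split/=.
  by apply: eq_bigr => i _; rewrite !mxE; ring.
Qed.

(** The reverse inequality is [volume_affine_le] applied to the inverse map. *)
Lemma volume_affine (l : R) (t : 'rV[R]_d) U : 0 < l ->
  volume [set (l *: x + t)%R | x in U] = ((l ^+ d)%:E * volume U)%E.
Proof.
move=> l0; apply/eqP; rewrite eq_le volume_affine_le//=.
have h : U `<=` [set l^-1 *: x + (- (l^-1 *: t)) | x in [set l *: x + t | x in U]].
  move=> x Ux; exists (l *: x + t); first by exists x.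
  by rewrite scalerDr scalerA mulVf ?lt0r_neq0// scale1r addrK.
have l1 : 0 < l^-1 by rewrite invr_gt0.
have := le_trans (volume_le h) (volume_affine_le _ _ l1).
rewrite -(@lee_pmul2l _ (l ^+ d)%:E) ?lte_fin ?exprn_gt0 // muleA -EFinM.
by rewrite -exprMn mulfV ?lt0r_neq0// expr1n mul1e.
Qed.

(** Positivity comes from the unit cube with corner [a], finiteness from the cover by one box. *)
Lemma volume_rectangle_itv a b : (0 < d)%N -> (forall i, a 0 i + 1 <= b 0 i) ->
  exists2 v : R, 0 < v <= \prod_i (b 0 i - a 0 i) & volume (rectangle a b) = v%:E.
Proof.
move=> d0 hab; have hle : (volume (rectangle a b) <= (\prod_i (b 0 i - a 0 i))%:E)%E.
  by apply: volume_rectangle_le => // i; apply: le_trans (hab i); rewrite lerDl.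
have hge : ((2 ^+ d)^-1%:E <= volume (rectangle a b))%E.
  apply: le_trans volume_unit_cube _.
  have := @volume_affine 1 a (rectangle 0 (const_mx 1)) ltr01.
  rewrite expr1n mul1e => <-; apply: volume_le => _ [x hx <-] i.
  have := hx i; have := hab i; rewrite !mxE mul1r => ? ?.
  by apply/andP; split; lra.
have hfin : volume (rectangle a b) \is a fin_num.
  by rewrite ge0_fin_numE ?volume_ge0// (le_lt_trans hle) ?ltry.
exists (fine (volume (rectangle a b))); last by rewrite fineK.
rewrite -lte_fin -[X in _ && X]lee_fin fineK// hle andbT (lt_le_trans _ hge)//.
by rewrite lte_fin invr_gt0 exprn_gt0.
Qed.

Lemma euclidean_ballE (x : 'rV[R]_d) (r : R) : 0 < r ->
  euclidean_ball x r = [set r *: y + x | y in euclidean_ball 0 1].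
Proof.
move=> r0; have hsq (y z : 'rV[R]_d) : (forall i, z 0 i - x 0 i = r * y 0 i) ->
    Num.sqrt (\sum_(i < d) (z 0 i - x 0 i) ^+ 2) =
    r * Num.sqrt (\sum_(i < d) (y 0 i - (0 : 'rV[R]_d) 0 i) ^+ 2).
  move=> h; rewrite -[r in RHS]gtr0_norm// -sqrtr_sqr -sqrtrM ?sqr_ge0// mulr_sumr.
  by congr Num.sqrt; apply: eq_bigr => i _; rewrite h mxE subr0 exprMn.
apply/seteqP; split => [z|_ [y hy <-]]; rewrite /euclidean_ball /=.
  move=> hz; exists (r^-1 *: (z - x)).
    rewrite /= -(ler_pM2l r0) mulr1 -(hsq _ z)// => i.
    by rewrite !mxE mulVKf ?lt0r_neq0.
  by rewrite scalerA mulfV ?lt0r_neq0// scale1r subrK.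
rewrite (hsq y) => [|i]; last by rewrite !mxE addrK.
by rewrite -[leRHS]mulr1 ler_pM2l.
Qed.

Lemma euclidean_ball_coord (x y : 'rV[R]_d) (r : R) i : 0 < r ->
  euclidean_ball x r y -> `|y 0 i - x 0 i| <= r.
Proof.
move=> r0; rewrite /euclidean_ball /=; apply: le_trans.
rewrite -sqrtr_sqr ler_sqrt ?sumr_ge0// => [|j _]; last exact: sqr_ge0.
by rewrite (bigD1 i)//= lerDl sumr_ge0// => j _; exact: sqr_ge0.
Qed.

(** The constant is the inverse volume of the unit ball, which is finite since the ball lies in a
    cube of side 2 and positive since it contains a cube of side [1 / d]. *)
Lemma volume_ball_radius : (0 < d)%N -> exists2 k : R, 0 < k &
  forall v : R, 0 < v -> exists2 r : R, 0 < r & r ^+ d = k * v /\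
    forall x : 'rV[R]_d, volume (euclidean_ball x r) = v%:E.
Proof.
move=> d0; pose B : set 'rV[R]_d := euclidean_ball 0 1.
have hfin : volume B \is a fin_num.
  rewrite ge0_fin_numE ?volume_ge0//.
  apply: (@le_lt_trans _ _
    (volume (rectangle (const_mx (-1)) (const_mx 1) : set 'rV[R]_d))).
    apply: volume_le => y hy i; rewrite !mxE.
    by have := euclidean_ball_coord i ltr01 hy; rewrite mxE subr0 ler_norml.
  apply: le_lt_trans (volume_rectangle_le d0 _) (ltry _) => i.
  by rewrite !mxE; lra.
have hpos : 0 < fine (volume B).
  rewrite -lte_fin fineK//.
  have dR : (0 < d%:R^-1 :> R) by rewrite invr_gt0 ltr0n.
  apply: (@lt_le_trans _ _ (volume
    [set (d%:R^-1 *: x + 0)%R | x in rectangle (0 : 'rV[R]_d) (const_mx 1)])).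
    rewrite volume_affine// mule_gt0 ?lte_fin ?exprn_gt0//.
    by apply: lt_le_trans volume_unit_cube; rewrite lte_fin invr_gt0 exprn_gt0.
  apply: volume_le => _ [y hy <-]; rewrite /B /euclidean_ball /=.
  rewrite -[leRHS]sqrtr1 ler_sqrt//.
  apply: (@le_trans _ _ (\sum_(i < d) d%:R^-1)).
    apply: ler_sum => i _; have := hy i; rewrite !mxE addr0 subr0 => /andP[y0 y1].
    apply: (@le_trans _ _ (d%:R^-1 * 1)); last by rewrite mulr1.
    rewrite expr2 ler_pM ?mulr_ge0 ?(ltW dR)//; first by rewrite -[leRHS]mulr1 ler_pM2l.
    by rewrite mulr_ile1 ?(ltW dR)// invf_le1 ?ler1n ?ltr0n.
  by rewrite sumr_const card_ord -(mulr_natr d%:R^-1) mulVf// pnatr_eq0 -lt0n.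
exists (fine (volume B))^-1; first by rewrite invr_gt0.
move=> v v0; set y := _ * v.
have y0 : 0 < y by rewrite mulr_gt0 ?invr_gt0.
have r0 : 0 < y `^ (d%:R^-1) by rewrite powR_gt0.
have rd : (y `^ (d%:R^-1)) ^+ d = y.
  rewrite -powR_mulrn ?ltW// -powRrM mulVf ?powRr1 ?ltW//.
  by rewrite pnatr_eq0 -lt0n.
exists (y `^ (d%:R^-1)) => //; split => // x.
rewrite euclidean_ballE// volume_affine// rd -(fineK hfin) -EFinM; congr EFin.
by rewrite /y mulrAC mulVf ?mul1r// lt0r_neq0.
Qed.

End Volume.

(** * Cubical cut and project sets *)

Section Geometry.
Variables (R : realType) (d c : nat) (P : cut_and_project R (d + c) d).
Implicit Types (x y n e : 'rV[R]_(d + c)) (m : 'rV[int]_d).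

Lemma mem_F_rho x : (x \in F_rho R (d + c) d) = (lsubmx x == 0).
Proof.
apply/idP/eqP => [/memv_sumP[v hv ->]|x0].
  apply/rowP => j; rewrite !mxE summxE big1 // => i di.
  have /vlineP[k ->] := hv i di; rewrite !mxE eqxx /=.
  by case: eqP => [/(congr1 val)/= h|]; rewrite ?mulr0//; have := ltn_ord j; lia.
rewrite (row_sum_delta x) (bigID (fun i : 'I_(d + c) => (d <= i)%N))/=.
rewrite [X in _ + X]big1 ?addr0 => [|i di].
  by apply: memv_sumr => i _; apply/vlineP; exists (x 0 i).
have id : (i < d)%N by rewrite ltnNge.
have -> : i = lshift c (Ordinal id) by apply: val_inj.
by have /rowP/(_ (Ordinal id)) := x0; rewrite !mxE => ->; rewrite scale0r.
Qed.

(** The matrix of the linear map whose graph is [cp_E P], read off from [cp_rho] on the first [d]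
    basis vectors. *)
Definition slope : 'M[R]_(d, c) :=
  rsubmx ((pid_mx d : 'M[R]_(d, d + c)) *m lin1_mx (cp_rho P)).

Lemma mul_pid_mx (u : 'rV[R]_d) : u *m pid_mx d = row_mx u (0 : 'rV_c).
Proof. by rewrite pid_mx_row mul_mx_row mulmx1 mulmx0. Qed.

(** [cp_rho] moves a vector only inside [F_rho], which keeps its left block, and it kills
    [F_rho]. *)
Lemma cp_rhoE x : cp_rho P x = row_mx (lsubmx x) (lsubmx x *m slope).
Proof.
have [hE h0] := cp_Frho_compl P.
have hF w : w - cp_rho P w \in F_rho R (d + c) d.
  have := daddv_pi_add h0 (_ : w \in _); rewrite hE memvf => /(_ isT) h.
  by rewrite -{1}h [X in X - _]addrC addrK memv_pi.
have hl w : lsubmx (cp_rho P w) = lsubmx w.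
  by have := hF w; rewrite mem_F_rho linearB subr_eq0 => /eqP.
have hF0 w : w \in F_rho R (d + c) d -> cp_rho P w = 0.
  move=> wF; apply/eqP; rewrite -memv0 -h0 memv_cap memv_pi /=.
  by rewrite -[X in X \in _](subKr w) rpredB.
rewrite -[LHS]hsubmxK hl; congr row_mx.
have -> : cp_rho P x = cp_rho P (lsubmx x *m pid_mx d).
  apply/eqP; rewrite -subr_eq0 -linearB; apply/eqP/hF0.
  by rewrite mem_F_rho mul_pid_mx linearB /= row_mxKl subrr.
by rewrite -(mul_rV_lin1 (cp_rho P)) -mulmxA -mulmx_rsub.
Qed.

Lemma mem_cp_E x : (x \in cp_E P) = (rsubmx x == lsubmx x *m slope).
Proof.
have [_ h0] := cp_Frho_compl P.
apply/idP/eqP => [xE|h].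
  by rewrite -[x in rsubmx x](daddv_pi_id h0 xE) -/(cp_rho P x) cp_rhoE row_mxKr.
by rewrite -(hsubmxK x) h -cp_rhoE memv_pi.
Qed.

(** The coordinates of the projection to [F_rho] along [cp_E P]. *)
Definition internal x : 'rV[R]_c := rsubmx x - lsubmx x *m slope.

Lemma internalD x y : internal (x + y) = internal x + internal y.
Proof. by rewrite /internal !linearD mulmxDl /= opprD addrACA. Qed.

Lemma internalN x : internal (- x) = - internal x.
Proof. by rewrite /internal !linearN mulNmx /= opprD. Qed.

Lemma internalB x y : internal (x - y) = internal x - internal y.
Proof. by rewrite internalD internalN. Qed.

Lemma internal_E x : (x \in cp_E P) = (internal x == 0).
Proof. by rewrite mem_cp_E subr_eq0. Qed.

Lemma sub_cp_rho x : x - cp_rho P x = row_mx 0 (internal x).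
Proof.
by rewrite cp_rhoE -{1}(hsubmxK x) opp_row_mx add_row_mx subrr.
Qed.

Lemma cp_stripD x e : e \in cp_E P -> cp_strip P x -> cp_strip P (x + e).
Proof.
move=> eE [w Ww [u uE <-]]; exists w => //; exists (u + e); last by rewrite addrA.
by rewrite /= rpredD.
Qed.

(** The strip is invariant under [cp_E P], so [x] may be projected along it into [F_rho], where the
    strip is the window. *)
Lemma cp_stripP x : cubical_window P ->
  cp_strip P x <-> forall i, 0 <= internal x 0 i < 1.
Proof.
move=> hW; have hrho : cp_rho P x \in cp_E P by exact: memv_pi.
have -> : cp_strip P x <-> cp_window P (row_mx 0 (internal x)).
  rewrite -sub_cp_rho; split => [h|[h _]].
    split; first by apply: cp_stripD => //; rewrite rpredN.
    by rewrite /= mem_F_rho sub_cp_rho row_mxKl.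
  by rewrite -(subrK (cp_rho P x) x); exact: cp_stripD.
rewrite hW; split => [[t ht tE] i|h].
  have /rowP/(_ (rshift d i)) := tE; rewrite row_mxEr => <-.
  rewrite summxE (bigD1 (rshift d i)) ?leq_addr//= big1 => [|j /andP[_ ji]].
    by rewrite addr0 !mxE !eqxx mulr1 ht ?leq_addr.
  by rewrite !mxE eq_sym (negbTE ji) andbF mulr0.
exists (fun j => (row_mx 0 (internal x) : 'rV_(d + c)) 0 j).
  move=> j; case: (split_ordP j) => k -> /=; last by rewrite row_mxEr.
  by have := ltn_ord k; lia.
rewrite [RHS]row_sum_delta [RHS](bigID (fun i : 'I_(d + c) => (d <= i)%N))/=.
rewrite [X in _ = _ + X]big1 ?addr0// => j.
case: (split_ordP j) => k -> /=; last by rewrite leq_addr.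
by rewrite row_mxEl mxE scale0r.
Qed.

(** * The points of the cut and project set, indexed by Z^d *)

Local Notation intv m := (map_mx (intr : int -> R) m).
Local Notation s := (cp_shift P).

Lemma ZpointP k (x : 'rV[R]_k) :
  reflect (exists n : 'rV[int]_k, x = intv n) (x \in @Zpoint R k).
Proof.
rewrite inE; apply: (iffP forallP) => [h|[n ->] i]; last by rewrite mxE intr_int.
exists (map_mx Num.floor x); apply/rowP => i.
by rewrite !mxE floorK.
Qed.

Lemma Zpoint_add k (x y : 'rV[R]_k) :
  x \in @Zpoint R k -> y \in @Zpoint R k -> x + y \in @Zpoint R k.
Proof.
by move=> /ZpointP[m ->] /ZpointP[n ->]; apply/ZpointP; exists (m + n); rewrite map_mxD.
Qed.

Lemma Zpoint_opp k (x : 'rV[R]_k) : x \in @Zpoint R k -> - x \in @Zpoint R k.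
Proof. by move=> /ZpointP[m ->]; apply/ZpointP; exists (- m); rewrite map_mxN. Qed.

Lemma mul_intv_slope m i : (intv m *m slope) 0 i = form slope m i.
Proof. by rewrite mxE; apply: eq_bigr => j _; rewrite mxE. Qed.

(** The only integer heights over [m] that put the shifted lattice point in the strip, as the window
    is half-open of side 1. *)
Definition level m : 'rV[int]_c :=
  \row_i - Num.floor (internal s 0 i - form slope m i).

Definition zlift m : 'rV[R]_(d + c) := row_mx (intv m) (intv (level m)).

Definition vertex m : 'rV[R]_(d + c) := cp_pi P (zlift m + s).

Lemma zlift_Zpoint m : zlift m \in @Zpoint R (d + c).
Proof. by apply/ZpointP; exists (row_mx m (level m)); rewrite map_row_mx. Qed.

Lemma internal_row (u : 'rV[int]_d) (v : 'rV[int]_c) i :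
  internal (row_mx (intv u) (intv v)) 0 i = (v 0 i)%:~R - form slope u i.
Proof. by rewrite /internal row_mxKl row_mxKr !mxE -mul_intv_slope !mxE. Qed.

Lemma internal_zlift m i : internal (zlift m + s) 0 i = phase slope (internal s) m i.
Proof.
by rewrite internalD mxE internal_row /phase /fpart mxE intrN; ring.
Qed.

Lemma zlift_strip m : cubical_window P -> cp_strip P (zlift m + s).
Proof. by move=> hW; apply/cp_stripP => // i; rewrite internal_zlift fpart_itv. Qed.

Lemma strip_zlift n : cubical_window P -> n \in @Zpoint R (d + c) ->
  cp_strip P (n + s) -> exists m, n = zlift m.
Proof.
move=> hW /ZpointP[k ->]; rewrite -{1 2}(hsubmxK k) map_row_mx.
move/cp_stripP => /(_ hW) h; exists (lsubmx k); congr row_mx; congr map_mx.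
apply/rowP => i; rewrite [RHS]mxE.
have := h i; rewrite internalD mxE internal_row => /andP[h1 h2].
apply/eqP; rewrite -eqr_oppLR; apply/eqP/esym/floor_def.
by rewrite intrD intrN; apply/andP; split; lra.
Qed.

Lemma cp_setP y : cubical_window P -> cp_set P y <-> exists m, y = vertex m.
Proof.
move=> hW; split=> [[x [hs [n /= hn nx]] <-]|[m ->]].
  rewrite -nx in hs *; by have [m ->] := strip_zlift hW hn hs; exists m.
exists (zlift m + s) => //; split; first exact: zlift_strip.
by exists (zlift m) => //=; exact: zlift_Zpoint.
Qed.

Lemma cp_pi_shift_inj : {in @Zpoint R (d + c) &, injective (fun n => cp_pi P (n + s))}.
Proof.
move=> x y hx hy /=; rewrite !linearD /= => /addIr; exact: cp_pi_inj.
Qed.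

Lemma tilde_vertex m : tilde P (vertex m) = zlift m.
Proof.
rewrite /tilde; case: xgetP => [n _ [hn hv]|/(_ (zlift m)) h].
  by apply: cp_pi_shift_inj => //; exact: zlift_Zpoint.
by case: h; split => //; exact: zlift_Zpoint.
Qed.

Lemma cp_pi_E e : e \in cp_E P -> cp_pi P e = e.
Proof. by move=> eE; apply: daddv_pi_id => //; case: (cp_Fpi_compl P). Qed.

Lemma rho_setP (Omega : set 'rV[R]_d) x :
  x \in cp_E P -> rho_set P Omega x <-> Omega (lsubmx x).
Proof.
move=> xE; split=> [[u hu <-]|h].
  by rewrite mul_pid_mx cp_rhoE !row_mxKl.
exists (lsubmx x) => //; rewrite mul_pid_mx cp_rhoE row_mxKl.
by move: xE; rewrite mem_cp_E => /eqP <-; rewrite hsubmxK.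
Qed.

Lemma cp_rho_E x : cp_rho P x \in cp_E P.
Proof. exact: memv_pi. Qed.

(** The translation matching the two patches sends the point over [m' + l] to a point of the set.
    Since [cp_pi] is injective on the lattice, the relation lifts to the integer points, whose right
    blocks are the levels. *)
Lemma patch_levelB (Omega : set 'rV[R]_d) m m' l : cubical_window P ->
  patch_equiv P Omega (vertex m) (vertex m') -> Omega (intv l) ->
  level (m + l) - level m = level (m' + l) - level m'.
Proof.
move=> hW hp hl.
have hpat : Defs.patch P (vertex m') Omega (vertex (m' + l)).
  split; first by apply/cp_setP => //; exists (m' + l).
  apply/rho_setP; first exact: cp_rho_E.
  rewrite cp_rhoE row_mxKl !tilde_vertex /zlift linearB /= !row_mxKl.
  by rewrite map_mxD addrC addKr.
have : Defs.patch P (vertex m) Omega (vertex (m' + l) + vertex m - vertex m').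
  by rewrite hp; exists (vertex (m' + l)).
case=> /(cp_setP _ hW)[k hk] _.
have : zlift (m' + l) + zlift m - zlift m' = zlift k.
  apply: cp_pi_shift_inj; rewrite ?Zpoint_add ?Zpoint_opp ?zlift_Zpoint//=.
  rewrite -[RHS]/(vertex k) -hk /vertex -!linearD -linearB /=; congr (cp_pi P _).
  by rewrite opprD [in RHS]addrA; apply/rowP => j; rewrite !mxE; ring.
have hlm (q q' : 'rV[int]_(d + c)) : intv q = intv q' -> q = q'.
  move=> /rowP h; apply/rowP => j; have := h j; rewrite !mxE => /eqP.
  by rewrite eqr_int => /eqP.
rewrite /zlift -!map_row_mx -map_mxD -map_mxB => /hlm.
rewrite add_row_mx opp_row_mx add_row_mx => /eq_row_mx[h1 h2].
have -> : m + l = k by rewrite -h1 addrAC addrC [m' + l]addrC addrK.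
by rewrite -h2 addrAC addrK.
Qed.

(** * Aperiodicity, density and recurrence of the phases *)

Lemma exprD_le (x y : R) k : 0 <= x -> 0 <= y ->
  (x + y) ^+ k <= 2 ^+ k * (x ^+ k + y ^+ k).
Proof.
move=> x0 y0; wlog xy : x y x0 y0 / x <= y.
  move=> h; case/orP: (le_total x y) => xy; first exact: h.
  by rewrite addrC [x ^+ k + _]addrC h.
apply: (@le_trans _ _ ((2 * y) ^+ k)).
  by rewrite lerXn2r ?nnegrE ?addr_ge0 ?mulr_ge0//; lra.
by rewrite exprMn ler_wpM2l ?exprn_ge0// lerDr exprn_ge0.
Qed.

Lemma phase_level m l i : phase slope (internal s) (m + l) i =
  phase slope (internal s) m i + ((level (m + l) - level m) 0 i)%:~R - form slope l i.
Proof.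
have formD : form slope (m + l) i = form slope m i + form slope l i.
  by rewrite -[l in m + l]opprK formB formN opprK.
by rewrite /phase /fpart !mxE intrB !intrN formD; ring.
Qed.

(** If all forms are integral at [m], the point of the graph over [m] lies in both the lattice and
    [cp_E P], so it is a period. *)
Lemma cubical_aperiodic : cubical_window P -> aperiodic P -> form_aperiodic slope.
Proof.
move=> hW ha m hm; pose e : 'rV[R]_(d + c) := row_mx (intv m) (intv m *m slope).
have eE : e \in cp_E P by rewrite mem_cp_E /e row_mxKl row_mxKr.
have eZ : e \in @Zpoint R (d + c).
  rewrite inE; apply/forallP => j; rewrite /e; case: (split_ordP j) => i ->.
    by rewrite row_mxEl mxE intr_int.
  by rewrite row_mxEr mul_intv_slope.
have hsub f y : f \in cp_E P -> f \in @Zpoint R (d + c) ->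
    cp_set P y -> cp_set P (y + f).
  move=> fE fZ [x [hs [n /= hn nx]] <-]; exists (x + f).
    split; first exact: cp_stripD.
    by exists (n + f); [exact: Zpoint_add | rewrite -nx addrAC].
  by rewrite linearD /= (cp_pi_E fE).
have e0 : e = 0.
  apply: ha => //; apply/seteqP; split => [_ [y hy <-]|y hy]; first exact: hsub.
  exists (y - e); last by rewrite subrK.
  by apply: hsub => //; rewrite ?rpredN ?Zpoint_opp.
apply/rowP => j; have /rowP/(_ (lshift c j)) := e0.
by rewrite row_mxEl !mxE => /eqP; rewrite intr_eq0 => /eqP.
Qed.

(** Density in the torus gives [f] in [cp_E P] and an integer vector [k] such that [f - k] is close
    to [s - (0, tau)]. As [f] has no internal part, the phase at the left block of [k] is close to
    [tau]. *)
Lemma cubical_phase_dense : totally_irrational P ->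
  phase_dense slope (internal s).
Proof.
move=> hd tau e e0 htau.
(* Errors below [e1] also keep each [tau i] inside (0, 1), so the fractional part does not wrap. *)
have [e1 e10 he1] := @finite_pos_lb R _
  (fun i => Num.min e (Num.min (tau i) (1 - tau i)))
  (fun i => ltac:(by have /andP[? ?] := htau i;
                     rewrite !lt_min e0 subr_gt0; apply/andP)).
pose M : R := 1 + \sum_j \sum_i `|slope j i|.
have M0 : 0 < M by rewrite ltr_wpDr// sumr_ge0// => j _; rewrite sumr_ge0.
pose r := e1 / 2 / M; have r0 : 0 < r by rewrite !divr_gt0.
pose p : 'rV[R]_(d + c) := s - row_mx 0 (\row_i tau i).
pose U : set 'rV[R]_(d + c) :=
  [set x | forall i, (p - const_mx r) 0 i < x 0 i < (p + const_mx r) 0 i].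
pose O : set (torus R (d + c)) := @to_torus R (d + c) @` U.
have hcong x y : to_torus x = to_torus y <-> x - y \in @Zpoint R (d + c).
  rewrite /to_torus; split=> [/eqmodP//|h]; exact/eqmodP.
have oO : open O.
  (* In the quotient topology openness is tested on the preimage, the union of the integer
     translates of [U]. *)
  suff : open (@to_torus R (d + c) @^-1` O) by [].
  have -> : @to_torus R (d + c) @^-1` O =
      \bigcup_(n in [set n | n \in @Zpoint R (d + c)]) [set x | U (x - n)].
    apply/seteqP; split => [x [u Uu /hcong hu]|x [n /= hn Ux]].
      exists (x - u); last by rewrite /= opprB addrC subrK.
      by rewrite /= -opprB Zpoint_opp.
    by exists (x - n) => //; apply/hcong; rewrite addrAC subrr add0r Zpoint_opp.
  apply: bigcup_open => n _.
  have -> : [set x | U (x - n)] = [set x : 'rV[R]_(d + c) | forall i,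
      (p - const_mx r + n) 0 i < x 0 i < (p + const_mx r + n) 0 i].
    by apply/seteqP; split => x /= h i; have := h i; rewrite !mxE => /andP[? ?];
       apply/andP; split; lra.
  exact: open_box.
have Op : O !=set0.
  by exists (to_torus p); exists p => // i; rewrite !mxE; apply/andP; split; lra.
have [_ [[u Uu <-] [f fE /hcong /ZpointP[k hk]]]] := hd O Op oO.
pose D := u - p.
have hD i : `|D 0 i| <= r.
  by have := Uu i; rewrite !mxE => /andP[? ?]; rewrite ler_norml;
     apply/andP; split; lra.
have hwD i : `|internal D 0 i| <= e1 / 2.
  have -> : internal D 0 i = rsubmx D 0 i - \sum_j lsubmx D 0 j * slope j i.
    by rewrite !mxE.
  have -> : e1 / 2 = r * M by rewrite /r divfK// lt0r_neq0.
  apply: le_trans (ler_normB _ _) _; rewrite /M mulrDr mulr1 lerD//.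
    by rewrite mxE.
  apply: le_trans (ler_norm_sum _ _ _) _; rewrite mulr_sumr; apply: ler_sum => j _.
  rewrite normrM ler_pM//; first by rewrite mxE.
  by rewrite (bigD1 i)//= lerDl sumr_ge0.
have hp : internal p = internal s - \row_i tau i.
  by rewrite internalB /internal row_mxKl row_mxKr mul0mx subr0.
exists (lsubmx k) => i.
have hE : internal s 0 i - form slope (lsubmx k) i =
    tau i - internal D 0 i + (- rsubmx k 0 i)%:~R.
  have := congr1 (fun x => internal x 0 i) hk.
  rewrite -[k in map_mx _ k](hsubmxK k) map_row_mx internal_row.
  have /eqP -> : internal (f - u) == - (internal D + internal p).
    rewrite internalB -internalD subrK.
    by rewrite (eqP (_ : internal f == 0)) -?internal_E// sub0r.
  by rewrite hp intrN !mxE; lra.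
have := he1 i; rewrite !le_min => /andP[h1 /andP[h2 h3]].
have := hwD i; rewrite ler_norml => /andP[h4 h5].
rewrite /phase (fpart_uniq hE); last by apply/andP; split; lra.
by rewrite ltr_norml; apply/andP; split; lra.
Qed.

(** LR puts a point with the patch of [n0] in a prescribed ball. Equal patches give equal levels by
    [patch_levelB], hence equal comparisons by [fpart_leE]; the index of that point differs from its
    position by a bounded amount, so a ball of radius [r] yields a cube of side about [2 r]. *)
Lemma cubical_box_recurrent : (0 < d)%N -> cubical_window P ->
  LR P (@integer_rectangles R d) -> box_recurrent slope (internal s).
Proof.
move=> d0 hW [c0 c00 hLR].
have [k k0 hk] := volume_ball_radius R d0.
pose M := lin1_mx (cp_pi P).
pose B : R := \sum_j \sum_i `|M j i|.
have B0 : 0 <= B by rewrite sumr_ge0// => j _; rewrite sumr_ge0.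
have hB x i : (forall j, `|x 0 j| <= 1) -> `|cp_pi P x 0 i| <= B.
  move=> hx; rewrite -[cp_pi P x](mul_rV_lin1 (cp_pi P)) mxE.
  apply: le_trans (ler_norm_sum _ _ _) _; apply: ler_sum => j _.
  rewrite normrM (le_trans (ler_piMl _ (hx j)))//.
  by rewrite (bigD1 i)//= lerDl sumr_ge0.
(* From [rho <= 2 r + (2 B + 1)] and [r ^ d = k c0 v] by [exprD_le]; the constant term is absorbed
   because the box has volume at least 1. *)
pose K := 2 ^+ d * (2 ^+ d * (k * c0) + (B *+ 2 + 1) ^+ d).
have K0 : 0 < K.
  rewrite mulr_gt0 ?exprn_gt0// ltr_pwDl// ?mulr_gt0 ?exprn_gt0//.
  by rewrite exprn_ge0// addr_ge0// mulrn_wge0.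
exists K => // a b hab.
pose a' : 'rV[R]_d := intv a; pose b' : 'rV[R]_d := intv b.
have hab' i : a' 0 i + 1 <= b' 0 i.
  by rewrite !mxE -[1]/(1%:~R) -intrD ler_int; have := hab i; lia.
have hprod : \prod_j (b' 0 j - a' 0 j) = \prod_j (b 0 j - a 0 j)%:~R.
  by apply: eq_bigr => j _; rewrite !mxE intrB.
have [v /andP[v0 vle] hv] := volume_rectangle_itv d0 hab'.
have [|r r0 [hr hball]] := hk (c0 * v); first exact: mulr_gt0.
rewrite hprod in vle; set V := \prod_j _ in vle *.
have V1 : 1 <= V.
  rewrite /V -hprod; elim/big_ind : _ => // [u w u1 w1|j _].
    exact: mulr_ege1.
  by rewrite lerBrDl; exact: hab'.
pose rho := (Num.trunc (r *+ 2 + B *+ 2)).+1.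
have hrho1 : r *+ 2 + B *+ 2 < rho%:R := truncnS_gt _.
have hrho2 : rho%:R <= r *+ 2 + (B *+ 2 + 1).
  rewrite /rho -natr1 [leRHS]addrA lerD2r truncn_le addr_ge0// mulrn_wge0//.
  exact: ltW.
exists rho.
  rewrite natrX; apply: (@le_trans _ _ ((r *+ 2 + (B *+ 2 + 1)) ^+ d)).
    by rewrite lerXn2r// nnegrE ?ler0n// (le_trans _ hrho2).
  apply: le_trans (exprD_le _ _ _) _.
  - by rewrite mulrn_wge0// ltW.
  - by rewrite addr_ge0// mulrn_wge0.
  rewrite /K -mulrA ler_pM2l ?exprn_gt0// mulrDl lerD//.
    by rewrite -[r *+ 2]mulr_natl exprMn hr -!mulrA ler_pM2l ?exprn_gt0// !ler_pM2l.
  by rewrite ler_peMr// exprn_ge0// addr_ge0// mulrn_wge0.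
move=> n0 x.
pose Omega : set 'rV[R]_d := rectangle a' b'.
have hOmega : @integer_rectangles R d Omega.
  exists a', b'; split => //.
    exists (a' + const_mx (1 / 2)).
    pose U := [set y : 'rV[R]_d | forall i, a' 0 i < y 0 i < b' 0 i].
    have hU : U `<=` Omega by move=> y hy i; have /andP[? ?] := hy i; rewrite !ltW.
    rewrite open_subsetE in hU; last exact: open_box.
    apply: hU => i.
    by have := hab' i; rewrite !mxE => ?; apply/andP; split; lra.
  move=> w hw; rewrite inE; apply/forallP => i.
  by case: (hw i) => ->; rewrite mxE intr_int.
pose C := [set y' | cp_set P y' /\ patch_equiv P Omega y' (vertex n0)].
have hC : is_pattern P Omega C.
  by exists (vertex n0) => //; apply/cp_setP => //; exists n0.
(* The offset [r + B] makes the admissible range of [n1 - x] start at 0; it then ends at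
   [2 r + 2 B], below [rho]. *)
pose ctr : 'rV[R]_d := intv x + lsubmx s + const_mx (r + B).
have hvol : volume (euclidean_ball ctr r) = (c0%:E * volume Omega)%E.
  by rewrite hball hv EFinM.
have [y [/(cp_setP _ hW)[n1 ->] hy] [_ hn1]] := hLR _ hOmega _ hC _ _ r0 hvol.
exists n1; last first.
  move=> m hm i.
  have hmO : Omega (intv m).
    by move=> j; rewrite !mxE !ler_int; exact: hm.
  have hlev := patch_levelB hW hn1 hmO.
  have hle q : (fpart (form slope m i) <= phase slope (internal s) q i) =
      ((level (q + m) - level q) 0 i == Num.floor (form slope m i)).
    by apply: fpart_leE; rewrite -?phase_level phase_itv.
  by rewrite !hle hlev.
have vE : vertex n1 \in cp_E P by exact: memv_pi.
move/(rho_setP _ vE) in hy.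
(* The projections [cp_pi] and [cp_rho] agree on [cp_E P], so on the lattice point they differ by
   the image of its internal part, whose coordinates are phases in [0, 1). *)
pose w : 'rV[R]_(d + c) := row_mx 0 (internal (zlift n1 + s)).
have hvE : vertex n1 = cp_rho P (zlift n1 + s) + cp_pi P w.
  rewrite -[X in X + _](cp_pi_E (cp_rho_E _)) -linearD /w -sub_cp_rho /=.
  by rewrite [in RHS]addrC subrK.
have hw j : `|w 0 j| <= 1.
  rewrite /w; case: (split_ordP j) => i ->.
    by rewrite row_mxEl mxE normr0.
  rewrite row_mxEr internal_zlift; have /andP[? ?] := phase_itv slope (internal s) n1 i.
  by rewrite ler_norml; apply/andP; split; lra.
move=> j; have := hB w (lshift c j) hw; rewrite ler_norml => /andP[hB1 hB2].
have := euclidean_ball_coord j r0 hy; rewrite hvE cp_rhoE.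
rewrite linearD /= row_mxKl linearD /= row_mxKl ler_norml.
have -> : (intv n1 + lsubmx s + lsubmx (cp_pi P w)) 0 j - ctr 0 j =
    (n1 0 j)%:~R - (x 0 j)%:~R + cp_pi P w 0 (lshift c j) - r - B.
  by rewrite !mxE; ring.
move=> /andP[h1 h2]; rewrite !mulr2n in hrho1.
rewrite -(ler_int R) -(ltr_int R) intrD -pmulrn; apply/andP; split; lra.
Qed.

End Geometry.

Theorem corollary1p3 (R : realType) (hL : littlewood R) (k d : nat)
    (hd : (1 <= d)%N) (hk : (d < k)%N) (hkd : (k, d) <> (2, 1)%N)
    (P : cut_and_project R k d) (hP : cubical P) :
  ~ LR P (@integer_rectangles R d).
Proof.
have [c kE] : exists c, k = (d + c)%N by exists (k - d)%N; rewrite subnKC// ltnW.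
subst k; case: hP => _ hirr haper hW hLR.
have c0 : (0 < c)%N by rewrite -(ltn_add2l d) addn0.
apply: (@not_box_recurrent R d c (slope P) (internal P (cp_shift P))) => //.
- by case=> c1 d1; apply: hkd; rewrite c1 d1.
- exact: cubical_phase_dense.
- exact: cubical_aperiodic.
- exact: cubical_box_recurrent.
Qed.
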